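(* For every $\mathrm{MSO}_2$ sentence $\varphi$ over digraphs and all $k,z\in\mathbb{N}$, one can effectively construct a $z$-dilated-saturated slice graph $\mathcal{SG}(\varphi,k,z)$ over the slice alphabet $\Sigma^{k\cdot z}$ whose graph language $\mathcal{L}_{\mathcal{G}}(\mathcal{SG}(\varphi,k,z))$ consists precisely of the digraphs of zig-zag number at most $z$ that satisfy $\varphi$ and are the union of $k$ directed paths.
   Context: Digraph notions: a vertex ordering $(v_1,\dots,v_n)$ of $H$ is $z$-topological if every directed simple path of $H$ has at most $z$ edges between $\{v_1,\dots,v_i\}$ and $\{v_{i+1},\dots,v_n\}$ for every $i$; the zig-zag number of $H$ is the least such $z$. $H$ is the union of $k$ directed paths if $H=p_1\cup\dots\cup p_k$ for directed paths $p_i$ (not necessarily disjoint). Slices: finite digraphs with vertex set partitioned into in-frontier $I$, center and out-frontier $O$, each frontier vertex incident to exactly one edge, no edge inside a frontier, orientation values $\pm1$ on edges, frontier vertices numbered injectively per frontier; width $\max\{|I|,|O|\}$; unit slices have at most one center vertex; permutation slices have none. Gluing fuses edges at equally numbered out-/in-frontier vertices (matching numbers and orientations required). $\Sigma^{c}$: unit slices of width $\le c$ with frontier numbers in $\{1,\dots,c\}$. A slice graph is a finite directed graph with initial and final vertices labelled by unit slices (initial vertices by slices with empty in-frontier, final vertices by slices with empty out-frontier, adjacent vertices by gluable slices); its slice language $\mathcal{L}(\mathcal{SG})$ is the set of label words of walks from an initial to a final vertex, and $\mathcal{L}_{\mathcal{G}}(\mathcal{SG})$ the set of digraphs obtained by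 gluing these words. A dilated unit decomposition of $H$ is a word of unit slices (permutation slices allowed) composing to $H$; it is compatible with an ordering $(v_1,\dots,v_n)$ of $V(H)$ if $v_i$ is the center vertex of the $j_i$-th slice for some $j_1<\dots<j_n$; it has zig-zag number at most $z$ if compatible with a $z$-topological ordering of $H$. A slice graph is $z$-dilated-saturated if every word of its language has zig-zag number at most $z$ and, for every $H\in\mathcal{L}_{\mathcal{G}}(\mathcal{SG})$, every $z$-topological ordering $\omega$ of $H$ and every dilated unit decomposition of $H$ (over the alphabet) compatible with $\omega$, that decomposition belongs to $\mathcal{L}(\mathcal{SG})$. $\mathrm{MSO}_2$: monadic second-order logic of digraphs with quantification over sets of vertices and sets of edges. *)

(* Defs.v *)
From mathcomp Require Import all_boot.
Set Implicit Arguments. Unset Strict Implicit. Unset Printing Implicit Defensive.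

(* Finite (multi)digraphs: vertices 0..dv-1, edges = list of (tail,head). *)
Record digraph := Digraph { dv : nat; de : seq (nat * nat) }.

Definition dg_wf (H : digraph) : bool :=
  all (fun p => (p.1 < dv H) && (p.2 < dv H)) (de H).

Definition dedge (H : digraph) (i : nat) : nat * nat := nth (0, 0) (de H) i.

Definition dpath (H : digraph) (vs es : seq nat) : bool :=
  [&& vs != [::], uniq vs, size es == (size vs).-1,
      all (fun v => v < dv H) vs, all (fun e => e < size (de H)) es &
      all (fun j => dedge H (nth 0 es j) == (nth 0 vs j, nth 0 vs j.+1))
          (iota 0 (size es))].

Definition is_ordering (H : digraph) (om : seq nat) : bool :=
  perm_eq om (iota 0 (dv H)).

Definition crosses (om : seq nat) (i : nat) (p : nat * nat) : bool :=
  (p.1 \in take i om) != (p.2 \in take i om).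

Definition ztopological (H : digraph) (om : seq nat) (z : nat) : Prop :=
  is_ordering H om /\
  forall vs es, dpath H vs es ->
    forall i, count (fun e => crosses om i (dedge H e)) es <= z.

Definition zigzag_le (H : digraph) (z : nat) : Prop :=
  exists om, ztopological H om z.

Definition union_of_paths (H : digraph) (k : nat) : Prop :=
  exists ps : seq (seq nat * seq nat),
    size ps = k /\ all (fun p => dpath H p.1 p.2) ps /\
    (forall v, v < dv H -> exists2 p, p \in ps & v \in p.1) /\
    (forall e, e < size (de H) -> exists2 p, p \in ps & e \in p.2).

Definition relabel (om : seq nat) (p : nat * nat) : nat * nat :=
  (nth 0 om p.1, nth 0 om p.2).

(* isomorphism of digraphs (the vertex bijection is the ordering om) *)
Definition dg_iso (G H : digraph) : Prop :=
  dv G = dv H /\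
  exists om, is_ordering G om /\ perm_eq (map (relabel om) (de G)) (de H).

(* MSO_2 over digraphs: vertex variables, edge variables,
   vertex-set variables, edge-set variables (four separate name spaces). *)
Inductive mso : Type :=
| VEq  : nat -> nat -> mso
| EEq  : nat -> nat -> mso
| Tail : nat -> nat -> mso
| Head : nat -> nat -> mso
| VIn  : nat -> nat -> mso
| EIn  : nat -> nat -> mso
| MNot : mso -> mso
| MAnd : mso -> mso -> mso
| ExV  : nat -> mso -> mso
| ExE  : nat -> mso -> mso
| ExVS : nat -> mso -> mso
| ExES : nat -> mso -> mso.

Definition upd {A : Type} (f : nat -> A) (x : nat) (a : A) : nat -> A :=
  fun y => if y == x then a else f y.

Fixpoint msat_env (H : digraph) (ev ee : nat -> nat)
    (sV sE : nat -> nat -> bool) (phi : mso) : Prop :=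
  match phi with
  | VEq x y => ev x = ev y
  | EEq e f => ee e = ee f
  | Tail e x => (dedge H (ee e)).1 = ev x
  | Head e x => (dedge H (ee e)).2 = ev x
  | VIn x X => sV X (ev x)
  | EIn e E => sE E (ee e)
  | MNot p => ~ msat_env H ev ee sV sE p
  | MAnd p q => msat_env H ev ee sV sE p /\ msat_env H ev ee sV sE q
  | ExV x p => exists v, v < dv H /\ msat_env H (upd ev x v) ee sV sE p
  | ExE e p => exists i, i < size (de H) /\ msat_env H ev (upd ee e i) sV sE p
  | ExVS X p => exists S : nat -> bool, msat_env H ev ee (upd sV X S) sE p
  | ExES E p => exists S : nat -> bool, msat_env H ev ee sV (upd sE E S) p
  end.

Fixpoint mso_scoped (bv be bV bE : seq nat) (phi : mso) : bool :=
  match phi with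
  | VEq x y => (x \in bv) && (y \in bv)
  | EEq e f => (e \in be) && (f \in be)
  | Tail e x | Head e x => (e \in be) && (x \in bv)
  | VIn x X => (x \in bv) && (X \in bV)
  | EIn e E => (e \in be) && (E \in bE)
  | MNot p => mso_scoped bv be bV bE p
  | MAnd p q => mso_scoped bv be bV bE p && mso_scoped bv be bV bE q
  | ExV x p => mso_scoped (x :: bv) be bV bE p
  | ExE e p => mso_scoped bv (e :: be) bV bE p
  | ExVS X p => mso_scoped bv be (X :: bV) bE p
  | ExES E p => mso_scoped bv be bV (E :: bE) p
  end.

Definition mso_sentence (phi : mso) : bool := mso_scoped [::] [::] [::] [::] phi.

Definition msat (H : digraph) (phi : mso) : Prop :=
  msat_env H (fun _ => 0) (fun _ => 0) (fun _ _ => false) (fun _ _ => false) phi.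

(* Slices.  A slice vertex is a pair (tag, number): tag 0 = in-frontier
   vertex with frontier number n, tag 1 = center vertex n (< s_nc),
   tag 2 = out-frontier vertex with frontier number n.  Frontier vertices
   are identified with their (injective) numbers.  A slice edge is
   ((tail, head), orientation) with orientation true = +1, false = -1. *)
Definition svtx := (nat * nat)%type.
Definition sedge := ((svtx * svtx) * bool)%type.

Record slice := Slice {
  s_nc : nat; s_in : seq nat; s_out : seq nat; s_edges : seq sedge }.

Definition slice0 := Slice 0 [::] [::] [::].

Definition valid_sv (S : slice) (v : svtx) : bool :=
  match v.1 with
  | 0 => v.2 \in s_in S
  | 1 => v.2 < s_nc S
  | 2 => v.2 \in s_out S
  | _ => false
  end.

Definition incident (v : svtx) (e : sedge) : bool := (e.1.1 == v) || (e.1.2 == v).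

Definition is_slice (S : slice) : bool :=
  [&& uniq (s_in S), uniq (s_out S),
      all (fun e : sedge => [&& valid_sv S e.1.1, valid_sv S e.1.2,
                     ~~ ((e.1.1.1 == 0) && (e.1.2.1 == 0)) &
                     ~~ ((e.1.1.1 == 2) && (e.1.2.1 == 2))]) (s_edges S),
      all (fun n => count (incident (0, n)) (s_edges S) == 1) (s_in S) &
      all (fun n => count (incident (2, n)) (s_edges S) == 1) (s_out S)].

Definition unit_slice (S : slice) : bool := is_slice S && (s_nc S <= 1).
Definition perm_slice (S : slice) : bool := is_slice S && (s_nc S == 0).
Definition swidth (S : slice) : nat := maxn (size (s_in S)) (size (s_out S)).

Definition in_alphabet (c : nat) (S : slice) : bool :=
  [&& unit_slice S, swidth S <= c &
      all (fun n => 0 < n <= c) (s_in S ++ s_out S)].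

Definition slice_equiv (S T : slice) : Prop :=
  s_nc S = s_nc T /\ perm_eq (s_in S) (s_in T) /\ perm_eq (s_out S) (s_out T)
  /\ perm_eq (s_edges S) (s_edges T).

Definition edge_at (S : slice) (v : svtx) : option sedge :=
  ohead [seq e <- s_edges S | incident v e].

Definition other (e : sedge) (v : svtx) : svtx :=
  if e.1.1 == v then e.1.2 else e.1.1.

(* gluability: out-frontier numbers of S = in-frontier numbers of T,
   fused edges have equal orientation and compatible direction *)
Definition gluable (S T : slice) : bool :=
  perm_eq (s_out S) (s_in T) &&
  all (fun n => match edge_at S (2, n), edge_at T (0, n) with
                | Some e1, Some e2 =>
                    (e1.2 == e2.2) && ((e1.1.2 == (2, n)) == (e2.1.1 == (0, n)))
                | _, _ => false
                end) (s_out S).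

(* follow an edge entering the in-frontier vertex n of the first slice of
   rest until a center vertex is reached: (offset, center) *)
Fixpoint trace (rest : seq slice) (n : nat) : option (nat * nat) :=
  match rest with
  | [::] => None
  | T :: rest' =>
      match edge_at T (0, n) with
      | None => None
      | Some e =>
          let u := other e (0, n) in
          if u.1 == 1 then Some (0, u.2)
          else if u.1 == 2 then
            match trace rest' u.2 with
            | Some p => Some (p.1.+1, p.2)
            | None => None
            end
          else None
      end
  end.

(* index of the center vertex c of the j-th slice in the glued digraph *)
Definition vidx (w : seq slice) (j c : nat) : nat :=
  sumn (map s_nc (take j w)) + c.

(* glued edges originating at edge e of the j-th slice (None = failure) *)
Definition gedge (w : seq slice) (j : nat) (e : sedge) : seq (option (nat * nat)) :=
  let t := e.1.1 in let h := e.1.2 in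
  if (t.1 == 1) && (h.1 == 1) then [:: Some (vidx w j t.2, vidx w j h.2)]
  else if (t.1 == 1) && (h.1 == 2) then
    [:: omap (fun p => (vidx w j t.2, vidx w (j.+1 + p.1) p.2))
             (trace (drop j.+1 w) h.2)]
  else if (t.1 == 2) && (h.1 == 1) then
    [:: omap (fun p => (vidx w (j.+1 + p.1) p.2, vidx w j h.2))
             (trace (drop j.+1 w) t.2)]
  else [::].

Definition glue_edges (w : seq slice) : seq (option (nat * nat)) :=
  flatten [seq flatten [seq gedge w j e | e <- s_edges (nth slice0 w j)]
          | j <- iota 0 (size w)].

(* the digraph obtained by gluing the word w; center vertices are
   numbered in the order of the slices of w *)
Definition glue (w : seq slice) : digraph :=
  Digraph (sumn (map s_nc w)) (pmap id (glue_edges w)).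

Definition word_ok (w : seq slice) : bool :=
  [&& ~~ nilp w, all is_slice w,
      s_in (head slice0 w) == [::], s_out (last slice0 w) == [::],
      path gluable (head slice0 w) (behead w) &
      all (fun o => o != None) (glue_edges w)].

(* Slice graphs. Vertices 0..sg_n-1 labelled by sg_lab. *)
Record slice_graph := SliceGraph {
  sg_n : nat; sg_lab : nat -> slice; sg_arcs : seq (nat * nat);
  sg_init : seq nat; sg_final : seq nat }.

Definition sg_wf (c : nat) (SG : slice_graph) : Prop :=
  (forall p, p \in sg_arcs SG -> p.1 < sg_n SG /\ p.2 < sg_n SG) /\
  (forall v, v \in sg_init SG -> v < sg_n SG /\ s_in (sg_lab SG v) = [::]) /\
  (forall v, v \in sg_final SG -> v < sg_n SG /\ s_out (sg_lab SG v) = [::]) /\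
  (forall v, v < sg_n SG -> in_alphabet c (sg_lab SG v)) /\
  (forall p, p \in sg_arcs SG -> gluable (sg_lab SG p.1) (sg_lab SG p.2)).

Definition in_lang (SG : slice_graph) (w : seq slice) : Prop :=
  exists vs : seq nat,
    [/\ vs != [::], size vs = size w, head 0 vs \in sg_init SG &
        last 0 vs \in sg_final SG] /\
    [/\
        (forall i, i.+1 < size vs -> (nth 0 vs i, nth 0 vs i.+1) \in sg_arcs SG) &
        forall i, i < size w -> slice_equiv (sg_lab SG (nth 0 vs i)) (nth slice0 w i)].

Definition in_LG (SG : slice_graph) (H : digraph) : Prop :=
  exists w, in_lang SG w /\ word_ok w /\ dg_iso (glue w) H.

(* w is a dilated unit decomposition of H over Sigma^c, compatible with the
   ordering om = (v_1,...,v_n): the i-th center (in slice order) is v_i *)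
Definition decomp_compat (c : nat) (w : seq slice) (H : digraph) (om : seq nat) : Prop :=
  [/\ word_ok w, all (in_alphabet c) w, dv (glue w) = dv H &
      perm_eq (map (relabel om) (de (glue w))) (de H)].

(* a unit decomposition has zig-zag number at most z: the ordering it is
   compatible with (slice order of centers) is z-topological *)
Definition word_zz_le (z : nat) (w : seq slice) : Prop :=
  ztopological (glue w) (iota 0 (dv (glue w))) z.

Definition dilated_saturated (z c : nat) (SG : slice_graph) : Prop :=
  (forall w, in_lang SG w -> word_zz_le z w) /\
  (forall H, dg_wf H -> in_LG SG H -> forall om, ztopological H om z ->
     forall w, decomp_compat c w H om -> in_lang SG w).

(* Main.v *)
Require Import Defs.
From mathcomp Require Import all_boot zify.
Set Implicit Arguments. Unset Strict Implicit. Unset Printing Implicit Defensive.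

(** The words [w] over unit slices whose glued digraph satisfies [phi], is the
    union of [k] directed paths and has the slice order as a [z]-topological
    ordering form a regular language, and a slice graph recognising it is what
    the theorem asks for.  Regularity is Buechi's argument on slice words:
    predicates on the vertex sets and edge sets of the glued digraph that are
    recognised by a deterministic automaton are closed under Boolean operations
    and set quantification, and the incidence atoms only require remembering a
    subset of the frontier.  Paths are MSO-definable (tails and heads are
    injective, and everything is reached from a start vertex of in-degree 0),
    so "union of [k] paths" and "some path crosses some prefix more than [z]
    times" are recognised as well.  All three properties are invariant under
    isomorphism, which yields saturation.  Conversely a [z]-topological
    ordering of a union of [k] paths has at most [k * z] edges across each
    cut, so cutting the digraph between consecutive vertices gives a
    decomposition of width at most [k * z]. *)

(** * Automata on slice words *)

(** Two obstacles shape the argument. Slices over a bounded width do not form a finite alphabet: the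
    edges are lists, compared only up to permutation, and a center may carry any number of loops.
    The automata therefore read slices directly, and finiteness is used only when a slice graph is
    built. There the letters are finite sets of edges, which suffices because a union of simple
    paths has no loops. Permuting the edge list of a slice renumbers the edges of the glued digraph,
    so acceptance is carried between equivalent words through the isomorphism invariance of the
    recognised property, not through the automaton. The second obstacle is effectiveness: an
    automaton is carried as data with each recognised predicate, and running it decides the
    predicate, which justifies the passages through double negation needed for implications and
    universal quantifiers. The factor [k] in the width [k * z] is the number of paths that can meet
    a cut, the factor [z] bounds the crossings of each. *)

Definition born (e : sedge) : bool :=
  [|| (e.1.1.1 == 1) && (e.1.2.1 == 1), (e.1.1.1 == 1) && (e.1.2.1 == 2)
    | (e.1.1.1 == 2) && (e.1.2.1 == 1)].

(** Gluing lists each edge once, at the slice of its leftmost end; an edge of [S] with an end in the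
    in-frontier only continues one listed further left. *)
Definition bedges (S : slice) : seq sedge := [seq e <- s_edges S | born e].

Definition nverts (w : seq slice) : nat := sumn (map s_nc w).

Definition pshift (n : nat) (p : nat * nat) : nat * nat := (n + p.1, n + p.2).

(** Vertex number, in the gluing of a slice with [nc] centers followed by [r], at which an edge end
    [u] of that slice lands; an end in the out-frontier is followed into [r]. *)
Definition vend (nc : nat) (r : seq slice) (u : svtx) : option nat :=
  if u.1 == 1 then Some u.2
  else omap (fun p => nc + vidx r p.1 p.2) (trace r u.2).

Definition bedge (nc : nat) (r : seq slice) (e : sedge) : option (nat * nat) :=
  if vend nc r e.1.1 is Some x then omap (pair x) (vend nc r e.1.2) else None.

Lemma gedge_head S r e :
  gedge (S :: r) 0 e = if born e then [:: bedge (s_nc S) r e] else [::].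
Proof.
rewrite /gedge /born /bedge /vend; case: e => [[[t1 t2] [h1 h2]] o] /=.
rewrite !drop0 /vidx /= !add0n.
by case: t1 => [|[|[|t1]]]; case: h1 => [|[|[|h1]]] //=;
  case: trace => //= -[p q]; rewrite addnA.
Qed.

Lemma gedge_behead S r j e :
  gedge (S :: r) j.+1 e = map (omap (pshift (s_nc S))) (gedge r j e).
Proof.
rewrite /gedge /vidx /pshift; case: e => [[[t1 t2] [h1 h2]] o] /=.
by case: t1 => [|[|[|t1]]]; case: h1 => [|[|[|h1]]] //=;
  rewrite ?addnA //; case: trace => //= -[p q]; rewrite !addnA.
Qed.

(** This recursive form drives the inductions on words: the born edges of the first slice come
    first, and the suffix keeps its edges with vertex numbers shifted. *)
Lemma glue_edges_cons S r :
  glue_edges (S :: r) = map (bedge (s_nc S) r) (bedges S)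
    ++ map (omap (pshift (s_nc S))) (glue_edges r).
Proof.
rewrite /glue_edges /=; congr (_ ++ _).
  rewrite /bedges; elim: (s_edges S) => //= e s IH; rewrite gedge_head.
  by case: (born e); rewrite /= IH.
rewrite -[1]addn0 iotaDl -map_comp map_flatten -map_comp.
congr flatten; apply: eq_map => j /=; rewrite map_flatten -map_comp.
by congr flatten; apply: eq_map => e /=; rewrite add1n gedge_behead.
Qed.

(* [A a] is the value of the set variable [a]. *)
Definition env := nat -> nat -> bool.
Definition shift (n : nat) (A : env) : env := fun a i => A a (n + i).
Definition eqenv (n : nat) (A A' : env) : Prop :=
  forall a i, i < n -> A a i = A' a i.

(** The set variables enter a step as whole functions rather than as bits of a product alphabet;
    [dlocal] demands that a step read only the bits of the centers and born edges of its slice. *)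
Record dfa := Dfa {
  dst : finType; d0 : dst;
  dstep : slice -> env -> env -> dst -> dst;
  dacc : dst -> bool }.

(* The word is read from right to left: a suffix is a graph in which the edges
   entering from the left are still missing their left ends. *)
Fixpoint run (D : dfa) (w : seq slice) (A B : env) : dst D :=
  if w is T :: r then
    dstep T A B (run D r (shift (s_nc T) A) (shift (size (bedges T)) B))
  else d0 D.

Definition dlocal (D : dfa) : Prop :=
  forall S A A' B B' (q : dst D), eqenv (s_nc S) A A' ->
    eqenv (size (bedges S)) B B' -> dstep S A B q = dstep S A' B' q.

Definition nedges (w : seq slice) : nat := size (glue_edges w).

Lemma nedges_cons S r : nedges (S :: r) = size (bedges S) + nedges r.
Proof. by rewrite /nedges glue_edges_cons size_cat !size_map. Qed.

Lemma nverts_cons S r : nverts (S :: r) = s_nc S + nverts r.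
Proof. by []. Qed.

Lemma run_local D : dlocal D -> forall w A A' B B',
  eqenv (nverts w) A A' -> eqenv (nedges w) B B' -> run D w A B = run D w A' B'.
Proof.
move=> HD; elim=> //= S r IH A A' B B' HA HB.
rewrite nedges_cons nverts_cons in HA HB *.
rewrite (IH _ (shift (s_nc S) A') _ (shift (size (bedges S)) B')).
- apply: HD => a i Hi; [apply: HA|apply: HB]; exact: ltn_addr.
- by move=> a i Hi; apply: HA; rewrite ltn_add2l.
- by move=> a i Hi; apply: HB; rewrite ltn_add2l.
Qed.

Definition wpred := seq slice -> env -> env -> Prop.

(** Unlike [word_ok], this passes to suffixes, whose in-frontier may be nonempty. *)
Definition good (c : nat) (w : seq slice) : bool :=
  all (in_alphabet c) w && all (fun o => o != None) (glue_edges w).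

(** A sigma type in [Type], so that the automaton can be projected out and fed to the construction
    of the slice graph. *)
Definition recog (c : nat) (P : wpred) : Type :=
  {D : dfa | dlocal D /\ forall w A B, good c w ->
     (dacc (run D w A B) <-> P w A B)}.

Section Recog.
Variable c : nat.

Lemma recog_iff (P P' : wpred) :
  (forall w A B, good c w -> P w A B <-> P' w A B) ->
  recog c P -> recog c P'.
Proof.
by move=> E [D [l r]]; exists D; split=> // w A B hw; rewrite r // E.
Qed.

Lemma recog_local P : recog c P -> forall w A A' B B', good c w ->
  eqenv (nverts w) A A' -> eqenv (nedges w) B B' -> P w A B <-> P w A' B'.
Proof.
by move=> [D [l r]] w A A' B B' hw hA hB; rewrite -!r // (run_local l hA hB).
Qed.

(** Running the automaton decides [P]; this takes the place of excluded middle for implications and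
    universal quantifiers. *)
Lemma recog_dec P : recog c P -> forall w A B, good c w ->
  {P w A B} + {~ P w A B}.
Proof.
move=> [D [l r]] w A B hw; move/(_ w A B hw): r.
by case: (dacc _) => r; [left; apply/r | right => /r].
Qed.

Lemma recog_not P : recog c P -> recog c (fun w A B => ~ P w A B).
Proof.
move=> [D [l r]]; exists (Dfa (d0 D) (@dstep D) (fun q => ~~ dacc q)); split=> //.
move=> w A B hw; have -> : forall A B, run (Dfa (d0 D) (@dstep D) (fun q => ~~ dacc q)) w A B
   = run D w A B by elim: w {hw} => //= S w IH A' B'; rewrite IH.
by rewrite /= -r //; split=> /negP.
Qed.

Lemma recog_and P P' : recog c P -> recog c P' ->
  recog c (fun w A B => P w A B /\ P' w A B).
Proof.
move=> [D [l r]] [D' [l' r']].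
set DD := @Dfa (dst D * dst D')%type (d0 D, d0 D')
  (fun S A B q => (dstep S A B q.1, dstep S A B q.2))
  (fun q => dacc q.1 && dacc q.2).
exists DD; split=> [S A A' B B' q hA hB|w A B hw].
  by rewrite /= (l S _ _ _ _ _ hA hB) (l' S _ _ _ _ _ hA hB).
have -> : forall A B, run DD w A B = (run D w A B, run D' w A B).
  by elim: w {hw} => //= S w IH A' B'; rewrite IH.
by rewrite /= -r // -r' //; split=> /andP.
Qed.

Lemma recog_imp P P' : recog c P -> recog c P' ->
  recog c (fun w A B => P w A B -> P' w A B).
Proof.
move=> h h'; apply: recog_iff (recog_not (recog_and h (recog_not h'))).
move=> w A B hw; split=> [H p|H [p]]; last by apply; apply: H.
by case: (recog_dec h' A B hw) => // n; case: H.
Qed.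

(** * Quantification over sets by the subset construction *)

Definition setfun n (X : {set 'I_n}) (i : nat) : bool :=
  if insub i is Some j then j \in X else false.

Lemma setfunE n (f : nat -> bool) i : i < n ->
  setfun [set j : 'I_n | f j] i = f i.
Proof. by move=> h; rewrite /setfun insubT inE. Qed.

(** At each slice the bits of the variable [a] on its centers are guessed. By locality no other bits
    matter, so finitely many guesses suffice. *)
Definition dexV (a : nat) (D : dfa) : dfa :=
  @Dfa {set dst D} [set d0 D]
    (fun S A B Q => [set q' | [exists q in Q, [exists X : {set 'I_(s_nc S)},
        q' == dstep S (upd A a (setfun X)) B q]]])
    (fun Q => [exists q in Q, dacc q]).

Definition dexE (a : nat) (D : dfa) : dfa :=
  @Dfa {set dst D} [set d0 D]
    (fun S A B Q => [set q' | [exists q in Q, [exists X : {set 'I_(size (bedges S))},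
        q' == dstep S A (upd B a (setfun X)) q]]])
    (fun Q => [exists q in Q, dacc q]).

Lemma eqenv_upd n A A' a X X' : eqenv n A A' -> {in gtn n, X =1 X'} ->
  eqenv n (upd A a X) (upd A' a X').
Proof. by move=> h hX b i hi; rewrite /upd; case: eqP => _; [apply: hX|apply: h]. Qed.

Lemma shift_upd n A a X b i :
  shift n (upd A a X) b i = upd (shift n A) a (fun i => X (n + i)) b i.
Proof. by rewrite /shift /upd; case: eqP. Qed.

Definition glueset (n : nat) (f g : nat -> bool) (i : nat) : bool :=
  if i < n then f i else g (i - n).

(** A witness for the whole word is the guess at the first slice glued to a witness for the suffix;
    locality makes both parts of the run insensitive to the rest of the witness. *)
Lemma run_dexV a D : dlocal D -> forall w A B q,
  reflect (exists X, q = run D w (upd A a X) B) (q \in run (dexV a D) w A B).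
Proof.
move=> l; elim=> [|S r IH] A B q.
  by rewrite /= inE; apply: (iffP eqP) => [->|[]] //; exists (fun _ => false).
rewrite /= inE; apply: (iffP exists_inP) => [[q1 /IH [X ->]] /existsP[Y /eqP->]|].
  exists (glueset (s_nc S) (setfun Y) X).
  rewrite [RHS](l _ _ (upd A a (setfun Y)) _ B) //.
    congr dstep; apply: run_local => // b i _; rewrite shift_upd.
    by rewrite /upd; case: eqP => // _; rewrite /glueset ltnNge leq_addr addKn.
  by apply: eqenv_upd => // i; rewrite inE /glueset => ->.
move=> [X ->]; exists (run D r (upd (shift (s_nc S) A) a (fun i => X (s_nc S + i)))
   (shift (size (bedges S)) B)); first by apply/IH; eexists.
apply/existsP; exists [set j : 'I_(s_nc S) | X j]; apply/eqP.
rewrite (l _ _ (upd A a X) _ B) //; last first.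
  by apply: eqenv_upd => // i; rewrite inE => hi; rewrite setfunE.
by congr dstep; apply: run_local => // b i _; rewrite shift_upd.
Qed.

Lemma run_dexE a D : dlocal D -> forall w A B q,
  reflect (exists X, q = run D w A (upd B a X)) (q \in run (dexE a D) w A B).
Proof.
move=> l; elim=> [|S r IH] A B q.
  by rewrite /= inE; apply: (iffP eqP) => [->|[]] //; exists (fun _ => false).
rewrite /= inE; set n := size _.
apply: (iffP exists_inP) => [[q1 /IH [X ->]] /existsP[Y /eqP->]|].
  exists (glueset n (setfun Y) X).
  rewrite [RHS](l _ _ A _ (upd B a (setfun Y))) //.
    congr dstep; apply: run_local => // b i _; rewrite shift_upd.
    by rewrite /upd; case: eqP => // _; rewrite /glueset ltnNge leq_addr addKn.
  by apply: eqenv_upd => // i; rewrite inE /glueset => ->.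
move=> [X ->]; exists (run D r (shift (s_nc S) A)
   (upd (shift n B) a (fun i => X (n + i)))); first by apply/IH; eexists.
apply/existsP; exists [set j : 'I_n | X j]; apply/eqP.
rewrite (l _ _ A _ (upd B a X)) //; last first.
  by apply: eqenv_upd => // i; rewrite inE => hi; rewrite setfunE.
by congr dstep; apply: run_local => // b i _; rewrite shift_upd.
Qed.

Lemma recog_exV a P : recog c P ->
  recog c (fun w A B => exists X, P w (upd A a X) B).
Proof.
move=> [D [l r]]; exists (dexV a D); split=> [S A A' B B' q hA hB|w A B hw].
  apply/setP => q'; rewrite !inE; apply: eq_existsb => q1; congr (_ && _).
  apply: eq_existsb => X; congr (_ == _).
  by apply: l => //; apply: eqenv_upd.
split=> [/exists_inP[q /(run_dexV _ l)[X ->] h]|[X h]].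
  by exists X; apply/r.
by apply/exists_inP; eexists; [apply/(run_dexV _ l); exists X | apply/r].
Qed.

Lemma recog_exE a P : recog c P ->
  recog c (fun w A B => exists X, P w A (upd B a X)).
Proof.
move=> [D [l r]]; exists (dexE a D); split=> [S A A' B B' q hA hB|w A B hw].
  apply/setP => q'; rewrite !inE; apply: eq_existsb => q1; congr (_ && _).
  apply: eq_existsb => X; congr (_ == _).
  by apply: l => //; apply: eqenv_upd.
split=> [/exists_inP[q /(run_dexE _ l)[X ->] h]|[X h]].
  by exists X; apply/r.
by apply/exists_inP; eexists; [apply/(run_dexE _ l); exists X | apply/r].
Qed.

Lemma recog_allV a P : recog c P ->
  recog c (fun w A B => forall X, P w (upd A a X) B).
Proof.
move=> h; apply: recog_iff (recog_not (recog_exV a (recog_not h))).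
move=> w A B hw; split=> [H X|H [X]]; last by apply.
by case: (recog_dec h (upd A a X) B hw) => // n; case: H; exists X.
Qed.

(* Boolean functions of the membership bits of one vertex (or edge). *)
Definition lext (p : (nat -> bool) -> bool) := forall s t, s =1 t -> p s = p t.

(** Meant for replacing a set variable by a Boolean combination of others, such as the union that
    accumulates covered vertices and edges. *)
Lemma recog_subst (fv fe : nat -> (nat -> bool) -> bool) P :
  (forall a, lext (fv a)) -> (forall a, lext (fe a)) -> recog c P ->
  recog c (fun w A B => P w (fun a i => fv a (A^~ i)) (fun a i => fe a (B^~ i))).
Proof.
move=> hv he [D [l r]].
set DD := @Dfa (dst D) (d0 D)
  (fun S A B q => dstep S (fun a i => fv a (A^~ i)) (fun a i => fe a (B^~ i)) q)
  (@dacc D).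
exists DD; split=> [S A A' B B' q hA hB|w A B hw].
  by apply: l => a i hi; [apply: hv|apply: he] => b; [apply: hA|apply: hB].
rewrite -r //.
suff -> : forall A B, run DD w A B
  = run D w (fun a i => fv a (A^~ i)) (fun a i => fe a (B^~ i)) by [].
by elim: w {hw} => //= S w IH A' B'; rewrite IH.
Qed.

Lemma iota_addn m n : iota m n = map (addn m) (iota 0 n).
Proof. by rewrite -iotaDl addn0. Qed.

Lemma count_iotaD p m n : count p (iota 0 (m + n)) =
  count p (iota 0 m) + count (fun i => p (m + i)) (iota 0 n).
Proof. by rewrite iotaD count_cat add0n (iota_addn m) count_map. Qed.

Lemma has_iotaD p m n : has p (iota 0 (m + n)) =
  has p (iota 0 m) || has (fun i => p (m + i)) (iota 0 n).
Proof. by rewrite iotaD has_cat add0n (iota_addn m) has_map. Qed.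

(** * Counting thresholds and prefixes of the vertex order *)

Definition sat_add j m (q : 'I_j.+1) : 'I_j.+1 := inord (minn j (m + q)).

Lemma sat_addE j m n (q : 'I_j.+1) : val q = minn j n ->
  val (sat_add m q) = minn j (m + n).
Proof. by move=> h; rewrite /= inordK ?h /=; lia. Qed.

Lemma recog_vcnt j p : lext p ->
  recog c (fun w A B => j <= count (fun i => p (A^~ i)) (iota 0 (nverts w))).
Proof.
move=> hp; set D := @Dfa 'I_j.+1 ord0
  (fun S A B q => sat_add (count (fun i => p (A^~ i)) (iota 0 (s_nc S))) q)
  (fun q => j <= q).
exists D; split=> [S A A' B B' q hA hB|w A B hw].
  congr sat_add; apply: eq_in_count => i; rewrite mem_iota => hi.
  by apply: hp => b; apply: hA.
rewrite /=; suff -> : (run D w A B : nat) = minn j (count (fun i => p (A^~ i)) (iota 0 (nverts w))).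
  by rewrite leq_min leqnn.
elim: w {hw} A B => [|S w IH] A B; first by rewrite minn0.
by rewrite nverts_cons count_iotaD; apply: sat_addE (IH _ _).
Qed.

Lemma recog_ecnt j p : lext p ->
  recog c (fun w A B => j <= count (fun i => p (B^~ i)) (iota 0 (nedges w))).
Proof.
move=> hp; set D := @Dfa 'I_j.+1 ord0
  (fun S A B q => sat_add (count (fun i => p (B^~ i)) (iota 0 (size (bedges S)))) q)
  (fun q => j <= q).
exists D; split=> [S A A' B B' q hA hB|w A B hw].
  congr sat_add; apply: eq_in_count => i; rewrite mem_iota => hi.
  by apply: hp => b; apply: hB.
rewrite /=; suff -> : (run D w A B : nat) = minn j (count (fun i => p (B^~ i)) (iota 0 (nedges w))).
  by rewrite leq_min leqnn.
elim: w {hw} A B => [|S w IH] A B; first by rewrite minn0.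
by rewrite nedges_cons count_iotaD; apply: sat_addE (IH _ _).
Qed.

(** A slice put in front of a suffix containing a member must consist of members only. The state is
    therefore the pair: does the suffix contain a member, and does it satisfy the condition. *)
Lemma recog_down a :
  recog c (fun w A B => pairwise (fun x y => y ==> x) (map (A a) (iota 0 (nverts w)))).
Proof.
set D := @Dfa (bool * bool)%type (false, true)
  (fun S A B q => let s := map (A a) (iota 0 (s_nc S)) in
    (has id s || q.1,
     [&& q.1 ==> all id s, pairwise (fun x y => y ==> x) s & q.2]))
  snd.
exists D; split=> [S A A' B B' q hA hB|w A B hw].
  rewrite /=; suff -> : map (A a) (iota 0 (s_nc S)) = map (A' a) (iota 0 (s_nc S)) by [].
  by apply/eq_in_map => i; rewrite mem_iota => hi; apply: hA.
suff -> : run D w A B = let s := map (A a) (iota 0 (nverts w)) in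
    (has id s, pairwise (fun x y => y ==> x) s) by [].
elim: w {hw} A B => [|S w IH] A B //=; rewrite IH nverts_cons /=.
rewrite iotaD map_cat has_cat pairwise_cat add0n (iota_addn (s_nc S)) -map_comp.
congr (_, [&& _, _ & _]) => /=; set t := map _ _; set s := map _ _.
rewrite /allrel; case: (boolP (has id t)) => ht /=.
  apply: eq_all => x; case: x => /=; first by apply/esym/allP => y _; rewrite implybT.
  by case/hasP: ht => y yt y1; apply/esym/allP => /(_ y yt); rewrite y1.
apply/esym/allP => x _; apply/allP => y yt; apply/implyP => y1.
by case/hasP: ht; exists y.
Qed.

(** * Incidence between edges and vertices *)

Definition sel (d : bool) (T : Type) (p : T * T) : T := if d then p.1 else p.2.

(** [d] is [true] for the tail and [false] for the head. A missing edge, out of range or with a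
    failed trace, is incident with nothing. *)
Definition einc (es : seq (option (nat * nat))) (d : bool) (e : nat)
  (X : nat -> bool) : bool :=
  if nth None es e is Some p then X (sel d p) else false.

Definition inc_end (f : nat -> bool) (T : {set 'I_c.+1}) (u : svtx) : bool :=
  if u.1 == 1 then f u.2 else setfun T u.2.

(* The second state component is the set of in-frontier numbers whose edge
   ends in the given vertex set further to the right. *)
Definition inc_front (S : slice) (f : nat -> bool) (T : {set 'I_c.+1}) :
    {set 'I_c.+1} :=
  [set m : 'I_c.+1 | if edge_at S (0, m : nat) is Some e then
     let u := other e (0, m : nat) in
     ((u.1 == 1) || (u.1 == 2)) && inc_end f T u else false].

Definition osat (f : nat -> bool) (o : option nat) : bool :=
  if o is Some x then f x else false.

Definition sedge0 : sedge := ((0, 0), (0, 0), false).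

Lemma trace_vend S r n :
  omap (fun p => vidx (S :: r) p.1 p.2) (trace (S :: r) n) =
  if edge_at S (0, n) is Some e then
    let u := other e (0, n) in
    if (u.1 == 1) || (u.1 == 2) then vend (s_nc S) r u else None
  else None.
Proof.
rewrite /=; case: edge_at => //= e; rewrite /vend.
case: eqP => [_|_] //=; case: eqP => //= _; case: trace => //= -[j i] /=.
by rewrite /vidx /= addnA.
Qed.

Lemma edge_at_mem S v e : edge_at S v = Some e -> e \in s_edges S /\ incident v e.
Proof.
rewrite /edge_at; case E: [seq _ <- _ | _] => [|f s] //= [ef].
have : f \in [seq e <- s_edges S | incident v e] by rewrite E mem_head.
by rewrite mem_filter ef => /andP[].
Qed.

Lemma slice_edge_valid S e : is_slice S -> e \in s_edges S ->
  valid_sv S e.1.1 /\ valid_sv S e.1.2.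
Proof. by move=> /and5P[_ _ /allP h _ _] /h /and4P[]. Qed.

Lemma slice_other_valid S e v : is_slice S -> e \in s_edges S ->
  valid_sv S (other e v).
Proof.
by move=> hS /(slice_edge_valid hS) []; rewrite /other; case: ifP.
Qed.

Lemma alphabet_slice S : in_alphabet c S -> is_slice S.
Proof. by rewrite /in_alphabet /unit_slice => /and3P[/andP[]]. Qed.

Lemma alphabet_out S n : in_alphabet c S -> n \in s_out S -> n < c.+1.
Proof.
by case/and3P=> _ _ /allP h hn; have := h n; rewrite mem_cat hn orbT => /(_ isT)/andP[].
Qed.

Lemma born_valid d e : born e -> (sel d e.1).1 = 1 \/ (sel d e.1).1 = 2.
Proof. by case: d; rewrite /born /sel; do ![case: eqP => //=]; auto. Qed.

(** An edge is tested at the slice where it is born. If its end lies further right, the frontier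
    number through which it leaves already tells whether that end satisfies [q]. Frontier numbers
    are at most [c], so a subset of ['I_c.+1] is enough memory. *)
Lemma recog_inc d p q : lext p -> lext q ->
  recog c (fun w A B => has (fun i => p (B^~ i) &&
    einc (glue_edges w) d i (fun v => q (A^~ v))) (iota 0 (nedges w))).
Proof.
move=> hp hq.
(* The guard makes the step local even on a malformed slice, whose edges may name nonexistent
   centers. *)
pose f S (A : env) v := (v < s_nc S) && q (A^~ v).
set D := @Dfa (bool * {set 'I_c.+1})%type (false, set0)
  (fun S A B t =>
    (has (fun i => p (B^~ i) && inc_end (f S A) t.2 (sel d (nth sedge0 (bedges S) i).1))
         (iota 0 (size (bedges S))) || t.1,
     inc_front S (f S A) t.2)) fst.
exists D; split=> [S A A' B B' t hA hB|w A B hw].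
  have ef : f S A =1 f S A'.
    by move=> v; rewrite /f; case: ltnP => //= hv; apply: hq => b; apply: hA.
  have ee T u : inc_end (f S A) T u = inc_end (f S A') T u.
    by rewrite /inc_end ef.
  congr (_ || _, _).
    apply: eq_in_has => i; rewrite mem_iota => hi; rewrite ee; congr (_ && _).
    by apply: hp => b; apply: hB.
  by apply/setP => m; rewrite !inE; case: edge_at => // e /=; rewrite ee.
(* The induction also needs the meaning of the second component: it holds the numbers whose trace
   ends at a vertex satisfying [q]. *)
rewrite /=; suff [-> _] : (run D w A B).1 = has (fun i => p (B^~ i) &&
    einc (glue_edges w) d i (fun v => q (A^~ v))) (iota 0 (nedges w))
  /\ forall m : 'I_c.+1, (m \in (run D w A B).2) =
      osat (fun v => q (A^~ v)) (omap (fun p => vidx w p.1 p.2) (trace w m)) by [].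
elim: w hw A B => [|S r IH]; first by move=> _ A B; split=> // m; rewrite inE.
case/andP=> /andP[hS hr] + A B; rewrite glue_edges_cons all_cat all_map.
case/andP=> hb; rewrite all_map => hg.
have {hr hg}hr : good c r.
  by apply/andP; split; [exact: hr | apply: sub_all hg => -[]].
rewrite ![run D (S :: r) _ _]/=; case: (IH hr (shift (s_nc S) A) (shift (size (bedges S)) B)) => {IH}.
set R := run _ _ _ _ => IH1 IH2.
have end_ok u : valid_sv S u -> u.1 = 1 \/ u.1 = 2 ->
    inc_end (f S A) R.2 u = osat (fun v => q (A^~ v)) (vend (s_nc S) r u).
  rewrite /valid_sv /inc_end /vend => hv [] hu; rewrite hu /= in hv *.
    by rewrite /f hv.
  have h := alphabet_out hS hv; rewrite /setfun insubT IH2 /=.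
  by case: trace.
split; last first.
  move=> m; rewrite trace_vend inE; case E: edge_at => [e|] //=; have [he _] := edge_at_mem E.
  case: ifP => //= h; apply: end_ok.
    exact: slice_other_valid (alphabet_slice hS) he.
  by case/orP: h => /eqP; auto.
rewrite nedges_cons has_iotaD IH1; congr (_ || _).
  apply: eq_in_has => i; rewrite mem_iota add0n => /andP[_ hi]; congr (_ && _).
  rewrite /einc nth_cat size_map hi (nth_map sedge0) //.
  have : nth sedge0 (bedges S) i \in bedges S by apply: mem_nth.
  set e := nth _ _ _; rewrite mem_filter => /andP[eb /slice_edge_valid].
  case/(_ (alphabet_slice hS)) => h1 h2.
  rewrite end_ok; [|by case: d {D R IH1 IH2 end_ok} => /=|exact: born_valid].
  have := allP hb _ (mem_nth sedge0 hi); rewrite -/e /= /bedge /sel.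
  by case: d {D R IH1 IH2 end_ok}; case: (vend _ _ e.1.1) => //= x;
    case: (vend _ _ e.1.2).
apply: eq_in_has => i; rewrite mem_iota add0n => /andP[_ hi]; congr (_ && _).
rewrite /einc nth_cat size_map ltnNge leq_addr addKn (nth_map None) //=.
by case: nth => //= -[x y]; rewrite /sel; case: d {D R IH1 IH2 end_ok}.
Qed.

End Recog.

(** * Definable predicates *)

Lemma count1_pred1 (X : nat -> bool) n : count X (iota 0 n) = 1 ->
  exists2 v, v < n & {in gtn n, X =1 pred1 v}.
Proof.
rewrite -size_filter; case E: [seq i <- _ | _] => [|v []] //= _.
have h i : (X i && (i < n)) = (i == v).
  by rewrite -(mem_seq1 i v) -E mem_filter mem_iota.
have /andP[_ hv] : X v && (v < n) by rewrite h.
by exists v => // i; rewrite inE => hi; rewrite /= -h hi andbT.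
Qed.

Lemma count_pred1_iota n v : v < n -> count (pred1 v) (iota 0 n) = 1.
Proof. by move=> h; rewrite count_uniq_mem ?iota_uniq // mem_iota h. Qed.

Lemma has_pred1_iota (p : nat -> bool) n v : v < n ->
  has (fun i => (i == v) && p i) (iota 0 n) = p v.
Proof.
move=> h; apply/hasP/idP => [[i _ /andP[/eqP->]] //|hp].
by exists v; rewrite ?mem_iota ?eqxx.
Qed.

Lemma lext1 a : lext (fun s => s a). Proof. by move=> s t ->. Qed.
Lemma lextI a b : lext (fun s => s a && s b). Proof. by move=> s t E; rewrite !E. Qed.
#[global] Hint Resolve lext1 lextI : core.

Section Derived.
Variable c : nat.

Lemma recog_vmeet a b :
  recog c (fun w A B => has (fun i => A a i && A b i) (iota 0 (nverts w))).
Proof.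
by apply: recog_iff (recog_vcnt c 1 (lextI a b)) => w A B _; rewrite has_count.
Qed.

Lemma recog_emeet a b :
  recog c (fun w A B => has (fun i => B a i && B b i) (iota 0 (nedges w))).
Proof.
by apply: recog_iff (recog_ecnt c 1 (lextI a b)) => w A B _; rewrite has_count.
Qed.

(** Singletons are the sets with at least one but not two members. As a recognised predicate sees
    only bits in range, such a set may be replaced by [pred1 v]. *)
Lemma recog_ex1V a P : recog c P ->
  recog c (fun w A B => exists v, v < nverts w /\ P w (upd A a (pred1 v)) B).
Proof.
move=> h; have := recog_exV a (recog_and (recog_and (recog_vcnt c 1 (lext1 a))
  (recog_not (recog_vcnt c 2 (lext1 a)))) h).
apply: recog_iff => w A B hw; rewrite /upd eqxx; split.
  case=> X [[h1 /negP h2] hP].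
  have /count1_pred1[v hv E] : count X (iota 0 (nverts w)) = 1.
    by apply/anti_leq/andP; split=> //; rewrite leqNgt.
  exists v; split=> //; apply: (proj1 (recog_local h hw _ _)) hP => //.
  by move=> b i hi; case: eqP => // _; rewrite E.
case=> v [hv hP]; exists (pred1 v); split=> //.
by rewrite (count_pred1_iota hv).
Qed.

Lemma recog_ex1E a P : recog c P ->
  recog c (fun w A B => exists e, e < nedges w /\ P w A (upd B a (pred1 e))).
Proof.
move=> h; have := recog_exE a (recog_and (recog_and (recog_ecnt c 1 (lext1 a))
  (recog_not (recog_ecnt c 2 (lext1 a)))) h).
apply: recog_iff => w A B hw; rewrite /upd eqxx; split.
  case=> X [[h1 /negP h2] hP].
  have /count1_pred1[v hv E] : count X (iota 0 (nedges w)) = 1.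
    by apply/anti_leq/andP; split=> //; rewrite leqNgt.
  exists v; split=> //; apply: (proj1 (recog_local h hw _ _)) hP => //.
  by move=> b i hi; case: eqP => // _; rewrite E.
case=> v [hv hP]; exists (pred1 v); split=> //.
by rewrite (count_pred1_iota hv).
Qed.

Lemma recog_all1V a P : recog c P ->
  recog c (fun w A B => forall v, v < nverts w -> P w (upd A a (pred1 v)) B).
Proof.
move=> h; apply: recog_iff (recog_not (recog_ex1V a (recog_not h))).
move=> w A B hw; split=> [H v hv|H [v [hv]]]; last by apply; apply: H.
by case: (recog_dec h (upd A a (pred1 v)) B hw) => // n; case: H; exists v.
Qed.

Lemma recog_all1E a P : recog c P ->
  recog c (fun w A B => forall e, e < nedges w -> P w A (upd B a (pred1 e))).
Proof.
move=> h; apply: recog_iff (recog_not (recog_ex1E a (recog_not h))).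
move=> w A B hw; split=> [H v hv|H [v [hv]]]; last by apply; apply: H.
by case: (recog_dec h A (upd B a (pred1 v)) hw) => // n; case: H; exists v.
Qed.

Lemma upd_eq T (f : nat -> T) a x : upd f a x a = x.
Proof. by rewrite /upd eqxx. Qed.

Lemma upd_neq T (f : nat -> T) a b x : b != a -> upd f a x b = f b.
Proof. by rewrite /upd => /negbTE->. Qed.

Lemma recog_allE_in a b P : b != a -> recog c P -> recog c (fun w A B =>
  forall e, e < nedges w -> B b e -> P w A (upd B a (pred1 e))).
Proof.
move=> nab h.
apply: recog_iff (recog_all1E a (recog_imp (recog_emeet a b) h)) => w A B hw.
by split=> H e he; have := H e he; rewrite upd_eq upd_neq //= has_pred1_iota.
Qed.

Lemma recog_allV_in a b P : b != a -> recog c P -> recog c (fun w A B =>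
  forall v, v < nverts w -> A b v -> P w (upd A a (pred1 v)) B).
Proof.
move=> nab h.
apply: recog_iff (recog_all1V a (recog_imp (recog_vmeet a b) h)) => w A B hw.
by split=> H e he; have := H e he; rewrite upd_eq upd_neq //= has_pred1_iota.
Qed.

(* First-order variables become singletons: the element variable [x] is the set
   variable [2x], and the set variable [X] is [2X+1]. *)
Fixpoint wsat (w : seq slice) (A B : env) (phi : mso) : Prop :=
  match phi with
  | VEq x y => has (fun i => A x.*2 i && A y.*2 i) (iota 0 (nverts w))
  | EEq e f => has (fun i => B e.*2 i && B f.*2 i) (iota 0 (nedges w))
  | Tail e x => has (fun i => B e.*2 i && einc (glue_edges w) true i (A x.*2))
                    (iota 0 (nedges w))
  | Head e x => has (fun i => B e.*2 i && einc (glue_edges w) false i (A x.*2))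
                    (iota 0 (nedges w))
  | VIn x X => has (fun i => A x.*2 i && A X.*2.+1 i) (iota 0 (nverts w))
  | EIn e E => has (fun i => B e.*2 i && B E.*2.+1 i) (iota 0 (nedges w))
  | MNot p => ~ wsat w A B p
  | MAnd p q => wsat w A B p /\ wsat w A B q
  | ExV x p => exists v, v < nverts w /\ wsat w (upd A x.*2 (pred1 v)) B p
  | ExE e p => exists i, i < nedges w /\ wsat w A (upd B e.*2 (pred1 i)) p
  | ExVS X p => exists S, wsat w (upd A X.*2.+1 S) B p
  | ExES E p => exists S, wsat w A (upd B E.*2.+1 S) p
  end.

Lemma recog_mso phi : recog c (fun w A B => wsat w A B phi).
Proof.
elim: phi => /=.
- by move=> x y; apply: recog_vmeet.
- by move=> x y; apply: recog_emeet.
- by move=> e x; apply: recog_inc (lext1 _) (lext1 _).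
- by move=> e x; apply: recog_inc (lext1 _) (lext1 _).
- by move=> x y; apply: recog_vmeet.
- by move=> x y; apply: recog_emeet.
- by move=> p; apply: recog_not.
- by move=> p hp q; apply: recog_and.
- by move=> x p; apply: recog_ex1V.
- by move=> x p; apply: recog_ex1E.
- by move=> x p; apply: recog_exV.
- by move=> x p; apply: recog_exE.
Qed.

(** [V] and [F] are to be the vertex and edge sets of one directed path. Reachability from [s] is
    expressed by the closed sets [Y]; it excludes the disjoint cycles and further paths that the
    degree conditions alone would allow. *)
Definition path_sets (n : nat) (es : seq (option (nat * nat))) (V F : nat -> bool) :=
  [/\ (forall d e, e < size es -> F e -> einc es d e V),
      (forall d e, e < size es -> F e -> forall f, f < size es -> F f ->
       forall v, v < n -> einc es d e (pred1 v) -> einc es d f (pred1 v) -> f = e)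
    & exists s, s < n /\ [/\ V s,
       (forall e, e < size es -> F e -> ~ einc es false e (pred1 s))
      & forall Y : nat -> bool, Y s ->
       (forall e, e < size es -> F e -> einc es true e Y -> einc es false e Y) ->
       forall v, v < n -> V v -> Y v]].

Lemma recog_allb (P : bool -> wpred) : (forall d, recog c (P d)) ->
  recog c (fun w A B => forall d, P d w A B).
Proof.
move=> h; apply: recog_iff (recog_and (h true) (h false)) => w A B _.
by split=> [[ht hf] [|]|H].
Qed.

Lemma recog_inc1 d a b : recog c (fun w A B =>
  has (fun i => B a i && einc (glue_edges w) d i (A b)) (iota 0 (nedges w))).
Proof. exact: recog_inc (lext1 _) (lext1 _). Qed.

Lemma recog_path_sets :
  recog c (fun w A B => path_sets (nverts w) (glue_edges w) (A 0) (B 0)).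
Proof.
have h1 : recog c (fun w A B => forall d e, e < nedges w -> B 0 e ->
    einc (glue_edges w) d e (A 0)).
  apply: recog_allb => d.
  apply: recog_iff (recog_allE_in (a := 1) (b := 0) isT (recog_inc1 d 1 0)).
  by move=> w A B hw; split=> H e he; have := H e he; rewrite /upd /= has_pred1_iota.
have h2 : recog c (fun w A B => forall d e, e < nedges w -> B 0 e ->
    forall f, f < nedges w -> B 0 f -> forall v, v < nverts w ->
    einc (glue_edges w) d e (pred1 v) -> einc (glue_edges w) d f (pred1 v) -> f = e).
  apply: recog_allb => d.
  apply: recog_iff (recog_allE_in (a := 1) (b := 0) isT
    (recog_allE_in (a := 2) (b := 0) isT (recog_all1V 1
      (recog_imp (recog_inc1 d 1 1) (recog_imp (recog_inc1 d 2 1)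
        (recog_emeet 2 1)))))) => w A B hw.
  split=> H e he Fe f hf Ff v hv; have := H e he Fe f hf Ff v hv; rewrite /upd /=;
    rewrite !has_pred1_iota //= => {}H a b; apply/eqP; exact: H.
have h3 : recog c (fun w A B => exists s, s < nverts w /\ [/\ A 0 s,
       (forall e, e < nedges w -> B 0 e -> ~ einc (glue_edges w) false e (pred1 s))
      & forall Y : nat -> bool, Y s ->
       (forall e, e < nedges w -> B 0 e -> einc (glue_edges w) true e Y ->
          einc (glue_edges w) false e Y) ->
       forall v, v < nverts w -> A 0 v -> Y v]).
  apply: recog_iff (recog_ex1V 1 (recog_and (recog_vmeet 1 0) (recog_and
    (recog_allE_in (a := 1) (b := 0) isT (recog_not (recog_inc1 false 1 1)))
    (recog_allV 2 (recog_imp (recog_vmeet 1 2) (recog_imp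
       (recog_allE_in (a := 1) (b := 0) isT
          (recog_imp (recog_inc1 true 1 2) (recog_inc1 false 1 2)))
       (recog_allV_in (a := 3) (b := 0) isT (recog_vmeet 3 2)))))))) => w A B hw.
  split=> -[s [hs]] => [[As [h4 h5]]|[As h4 h5]]; exists s; split=> //;
    rewrite /upd /= ?has_pred1_iota // in As h4 h5 *; split=> //.
  - by move=> e he Fe; have := h4 e he Fe; rewrite has_pred1_iota.
  - move=> Y Ys HY v hv Vv; have := h5 Y; rewrite has_pred1_iota // => /(_ Ys _ v hv Vv).
    rewrite has_pred1_iota //; apply => e he Fe; rewrite !has_pred1_iota //; exact: HY.
  - split; first by move=> e he Fe; rewrite has_pred1_iota //; apply: h4.
    move=> Y; rewrite has_pred1_iota // => Ys HY v hv Vv; rewrite has_pred1_iota //.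
    by apply: h5 v hv Vv => // e he Fe; have := HY e he Fe; rewrite !has_pred1_iota.
apply: recog_iff (recog_and h1 (recog_and h2 h3)) => w A B _.
by split=> [[? []]|[]].
Qed.

(* [U] and [W] accumulate the vertices and edges covered so far. *)
Fixpoint pcover k n (es : seq (option (nat * nat))) (U W : nat -> bool) : Prop :=
  if k is k'.+1 then exists V F, path_sets n es V F /\
    pcover k' n es (fun v => U v || V v) (fun e => W e || F e)
  else (forall v, v < n -> U v) /\ (forall e, e < size es -> W e).

Lemma recog_pcover k :
  recog c (fun w A B => pcover k (nverts w) (glue_edges w) (A 1) (B 1)).
Proof.
elim: k => [|k IH] /=.
  apply: recog_iff (recog_and (recog_all1V 0 (recog_vmeet 0 1))
                     (recog_all1E 0 (recog_emeet 0 1))) => w A B _.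
  split=> -[h1 h2]; split=> v hv; [have := h1 v hv | have := h2 v hv
    | have := h1 v hv | have := h2 v hv]; by rewrite /upd /= has_pred1_iota.
(* Variable 0 holds the new path and variable 1 what is covered so far; [f] performs the update for
   vertices and edges alike. *)
pose f a (s : nat -> bool) := if a == 1 then s 1 || s 0 else s a.
have hf a : lext (f a) by move=> s t E; rewrite /f !E.
apply: recog_iff (recog_exV 0 (recog_exE 0 (recog_and recog_path_sets
  (recog_subst hf hf IH)))) => w A B _.
by split.
Qed.

(* The [pairwise] condition says that [X] is a prefix of the vertex order. *)
Definition zigzag_bad z n (es : seq (option (nat * nat))) : Prop :=
  exists V F X (G : nat -> bool), [/\ path_sets n es V F,
    pairwise (fun x y => y ==> x) (map X (iota 0 n)),
    (forall e, e < size es -> G e -> F e /\ ~ (einc es true e X <-> einc es false e X))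
    & z < count G (iota 0 (size es))].

Lemma recog_zigzag_bad z :
  recog c (fun w A B => zigzag_bad z (nverts w) (glue_edges w)).
Proof.
apply: recog_iff (recog_exV 0 (recog_exE 0 (recog_exV 1 (recog_exE 1
  (recog_and recog_path_sets (recog_and (recog_down c 1) (recog_and
    (recog_allE_in (a := 2) (b := 1) isT (recog_and (recog_emeet 2 0)
       (recog_not (recog_and (recog_imp (recog_inc1 true 2 1) (recog_inc1 false 2 1))
                    (recog_imp (recog_inc1 false 2 1) (recog_inc1 true 2 1))))))
    (recog_ecnt c z.+1 (lext1 1)))))))))
  => w A B _.
split=> -[V [F [X [G]]]] => [[h1 [h2 [h3 h4]]]|[h1 h2 h3 h4]]; exists V, F, X, G.
  split=> // e he Ge; have := h3 e he Ge; rewrite /upd /= !has_pred1_iota //.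
do 2 (split=> //); split=> // e he Ge; have := h3 e he Ge.
by rewrite /upd /= !has_pred1_iota.
Qed.

End Derived.

(** * Directed paths in MSO *)

Lemma einc_Some (s : seq (nat * nat)) n d e X : e < size s ->
  einc (map Some s) d e X = X (sel d (nth n s e)).
Proof. by move=> h; rewrite /einc (nth_map n). Qed.

Lemma dg_wf_end H d e : dg_wf H -> e < size (de H) -> sel d (dedge H e) < dv H.
Proof. by move=> /allP h he; case/andP: (h _ (mem_nth (0, 0) he)); case: d. Qed.

Lemma dpathP H vs es : reflect
  [/\ uniq vs, size vs = (size es).+1, {in vs, forall v, v < dv H},
      {in es, forall e, e < size (de H)} &
      forall j, j < size es -> dedge H (nth 0 es j) = (nth 0 vs j, nth 0 vs j.+1)]
  (dpath H vs es).
Proof.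
apply: (iffP and5P) => [[h0 h1 /eqP h2 /allP h3 /andP[/allP h4 /allP h5]]|[h1 h2 h3 h4 h5]].
  split=> // [|j hj]; first by rewrite h2 prednK // lt0n size_eq0.
  by apply/eqP/h5; rewrite mem_iota.
split=> //; first by case: vs h2 {h1 h3 h5}.
- by rewrite h2.
- by apply/allP.
- apply/andP; split; first by apply/allP.
  by apply/allP => j; rewrite mem_iota => /h5 ->.
Qed.

Section SpathDpath.
Variables (H : digraph) (wfH : dg_wf H).
Let n := dv H.
Let m := size (de H).
Let es := map Some (de H).

Definition dinj (F : nat -> bool) : Prop := forall d e f, e < m -> f < m ->
  F e -> F f -> sel d (dedge H e) = sel d (dedge H f) -> f = e.

Lemma dpath_rcons vs p f : dpath H vs p -> f < m ->
  last 0 vs = (dedge H f).1 -> (dedge H f).2 \notin vs ->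
  dpath H (rcons vs (dedge H f).2) (rcons p f).
Proof.
move=> /dpathP[h1 h2 h3 h4 h5] hf hl hn; apply/dpathP; split.
- by rewrite rcons_uniq hn.
- by rewrite !size_rcons h2.
- move=> v; rewrite mem_rcons inE => /predU1P[->|/h3 //].
  exact: (dg_wf_end false wfH hf).
- by move=> e; rewrite mem_rcons inE => /predU1P[->|/h4].
move=> j; rewrite size_rcons ltnS leq_eqVlt => /predU1P[->|hj].
  rewrite !nth_rcons h2 ltnS leqnn ltnn !eqxx ltnn.
  by rewrite -[size p]/((size p).+1.-1) -h2 nth_last hl; case: (dedge H f).
by rewrite !nth_rcons hj h2 !ltnS hj (ltnW hj) h5.
Qed.

Lemma dpath_size vs p : dpath H vs p -> size vs <= n.
Proof.
move=> /dpathP[h1 _ h3 _ _]; rewrite -(size_iota 0 n); apply: uniq_leq_size => // v.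
by move/h3; rewrite mem_iota.
Qed.

(** The start has no incoming [F]-edge. A return to a later vertex would, by injectivity of heads,
    make [f] the path edge entering it; but the tail of that edge is not the last vertex of the
    path. *)
Lemma dpath_fresh (F : nat -> bool) s vs p f : dinj F ->
  (forall e, e < m -> F e -> (dedge H e).2 != s) ->
  dpath H vs p -> nth 0 vs 0 = s -> {in p, forall e, F e} ->
  f < m -> F f -> (dedge H f).1 = last 0 vs -> (dedge H f).2 \notin vs.
Proof.
move=> Finj Fs /dpathP[h1 h2 h3 h4 h5] hs hF hf Ff hl.
apply/negP => /(nthP 0)[[|i] hi Ei].
  by have := Fs f hf Ff; rewrite -Ei hs eqxx.
have hi' : i < size p by rewrite h2 in hi.
have ip := mem_nth 0 hi'.
have E : f = nth 0 p i.
  by apply: (Finj false _ _ (h4 _ ip) hf (hF _ ip) Ff); rewrite /sel h5.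
have : nth 0 vs i = nth 0 vs (size p).
  by rewrite -[size p]/((size p).+1.-1) -h2 nth_last -hl E h5.
by move/eqP; rewrite nth_uniq ?h2 ?ltnS ?(ltnW hi') // ltn_eqF.
Qed.

(** Greedy extension stops because a simple path has at most [n] vertices. *)
Lemma dpath_maximal (F : nat -> bool) s vs p : dinj F ->
  (forall e, e < m -> F e -> (dedge H e).2 != s) ->
  dpath H vs p -> nth 0 vs 0 = s -> {in p, forall e, F e} ->
  exists vs' p', [/\ dpath H vs' p', nth 0 vs' 0 = s, {in p', forall e, F e} &
    forall f, f < m -> F f -> (dedge H f).1 != last 0 vs'].
Proof.
move=> Finj Fs; move Ek: (n - size vs) => k.
elim: k vs p Ek => [|k IH] vs p Ek hp hs hF.
  exists vs, p; split=> // f hf Ff; apply/eqP => hl.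
  have hn := dpath_fresh Finj Fs hp hs hF hf Ff hl.
  by have /dpath_size := dpath_rcons hp hf (esym hl) hn; rewrite size_rcons; lia.
case: (boolP (has (fun f => F f && ((dedge H f).1 == last 0 vs)) (iota 0 m))).
  case/hasP=> f; rewrite mem_iota /= add0n => hf /andP[Ff /eqP hl].
  apply: (IH (rcons vs (dedge H f).2) (rcons p f)).
  - by rewrite size_rcons; lia.
  - by apply: dpath_rcons => //; apply: (dpath_fresh Finj Fs hp hs hF hf Ff hl).
  - by rewrite nth_rcons; case: (vs) hp hs => [/dpathP[]|].
  - by move=> e; rewrite mem_rcons inE => /predU1P[->|/hF].
move/hasPn=> hn; exists vs, p; split=> // f hf Ff.
by have := hn f; rewrite mem_iota hf Ff => /(_ isT).
Qed.

Lemma path_setsP V F : path_sets n es V F <-> exists vs p, [/\ dpath H vs p,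
  forall v, v < n -> V v = (v \in vs) & forall e, e < m -> F e = (e \in p)].
Proof.
have Em : size es = m by rewrite size_map.
have Ei d e X : e < m -> einc es d e X = X (sel d (dedge H e)).
  by move=> he; apply: einc_Some.
split; last first.
  case=> vs [p [/dpathP[h1 h2 h3 h4 h5] HV HF]]; rewrite /path_sets !Em.
  have Ex e : e < m -> F e -> exists2 j, j < size p &
      e = nth 0 p j /\ dedge H e = (nth 0 vs j, nth 0 vs j.+1).
    by move=> he; rewrite HF // => /(nthP 0)[j hj <-]; exists j; rewrite ?h5.
  split.
  - move=> d e he Fe; rewrite Ei // HV ?dg_wf_end //.
    have [j hj [_ ->]] := Ex e he Fe.
    by case: d; rewrite /sel /= mem_nth // h2 ltnS // ltnW.
  - move=> d e he Fe f hf Ff v hv; rewrite !Ei //.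
    have [j hj [-> ->]] := Ex e he Fe; have [i hi [-> ->]] := Ex f hf Ff.
    move=> /eqP a /eqP b; congr nth; apply/eqP.
    have : sel d (nth 0 vs i, nth 0 vs i.+1) = sel d (nth 0 vs j, nth 0 vs j.+1).
      by rewrite a b.
    case: d {a b}; rewrite /sel /= => /eqP; rewrite nth_uniq // h2 ltnS //;
    exact: ltnW.
  have h0 : nth 0 vs 0 \in vs by rewrite mem_nth // h2.
  exists (nth 0 vs 0); split; first exact: h3.
  split; first by rewrite HV // h3.
    move=> e he Fe; rewrite Ei //; have [j hj [_ ->]] := Ex e he Fe.
    by rewrite /sel /= nth_uniq // h2.
  move=> Y Y0 HY v hv; rewrite HV // => /(nthP 0)[j + <-].
  elim: j => // j IH hj; have hj' : j < size p by rewrite h2 in hj.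
  have hp : nth 0 p j < m by apply/h4/mem_nth.
  have := HY _ hp; rewrite HF // mem_nth // !Ei // h5 // => /(_ isT); apply.
  by apply: IH; apply: ltnW.
case=> h1 h2 [s [hs [Vs h3 h4]]]; rewrite !Em in h1 h2 h3 h4.
have Finj : dinj F.
  move=> d e f he hf Fe Ff E; apply: (h2 d e he Fe f hf Ff (sel d (dedge H e))).
  - exact: dg_wf_end.
  - by rewrite Ei //= eqxx.
  - by rewrite Ei //= E eqxx.
have Fs e : e < m -> F e -> (dedge H e).2 != s.
  by move=> he Fe; apply/negP => E; apply: (h3 e he Fe); rewrite Ei.
have p0 : dpath H [:: s] [::].
  by apply/dpathP; split=> // v; rewrite inE => /eqP->.
have F0 : {in [::], forall e : nat, F e} by [].
(* A maximal [F]-path from [s] turns out to be all of [V] and [F]. *)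
have [vs [p [hp hvs hF hmax]]] := dpath_maximal Finj Fs p0 erefl F0.
have [d1 d2 d3 d4 d5] := dpathP _ _ _ hp.
(* By maximality no [F]-edge leaves the last vertex, and by injectivity of tails an [F]-edge leaving
   any other vertex of the path is the path's own edge. Hence [vs] is closed under [F] and contains
   [V]. *)
have tl e : e < m -> F e -> (dedge H e).1 \in vs ->
    exists2 j, j < size p & e = nth 0 p j.
  move=> he Fe /(nthP 0)[j hj Ej]; have := hmax e he Fe.
  move: hj; rewrite d2 ltnS leq_eqVlt => /predU1P[E|hj _].
    by rewrite -Ej E -[size p]/((size p).+1.-1) -d2 nth_last eqxx.
  exists j => //; have jp := mem_nth 0 hj.
  by apply: (Finj true _ _ (d4 _ jp) he (hF _ jp) Fe); rewrite /sel d5.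
have Vvs v : v < n -> V v -> v \in vs.
  apply: (h4 (fun v => v \in vs)).
    by rewrite -hvs mem_nth // d2.
  move=> e he Fe; rewrite !Ei // => /(tl e he Fe)[j hj ->].
  by rewrite d5 //= mem_nth // d2 ltnS.
exists vs, p; split=> // [v hv|e he]; apply/idP/idP.
- exact: Vvs.
- case/(nthP 0) => -[|j] hj <-; first by rewrite hvs.
  have hj' : j < size p by rewrite d2 in hj.
  have jp := mem_nth 0 hj'; have := h1 false _ (d4 _ jp) (hF _ jp).
  by rewrite Ei ?d4 // /sel d5.
- move=> Fe; have := h1 true e he Fe; rewrite Ei // => Vt.
  have [j hj ->] := tl e he Fe (Vvs _ (dg_wf_end true wfH he) Vt).
  exact: mem_nth.
- exact: hF.
Qed.

Lemma pcoverP k U W : pcover k n es U W <-> exists ps : seq (seq nat * seq nat),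
  [/\ size ps = k, all (fun p => dpath H p.1 p.2) ps,
    (forall v, v < n -> U v \/ exists2 p, p \in ps & v \in p.1) &
    (forall e, e < m -> W e \/ exists2 p, p \in ps & e \in p.2)].
Proof.
elim: k U W => [|k IH] U W /=.
  rewrite size_map; split=> [[h1 h2]|[ps [/size0nil -> _ h1 h2]]].
    by exists [::]; split=> // v hv; left; auto.
  by split=> v hv; [case: (h1 v hv) | case: (h2 v hv)] => // -[].
split.
  case=> V [F [/path_setsP[vs [p [hp hV hF]]] /IH[ps [<- h1 h2 h3]]]].
  exists ((vs, p) :: ps); split=> //=; first by rewrite hp.
    move=> v hv; case: (h2 v hv) => [/orP[|]|[q qps vq]]; first by left.
      by rewrite hV // => hvs; right; exists (vs, p); rewrite ?mem_head.
    by right; exists q; rewrite // inE qps orbT.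
  move=> v hv; case: (h3 v hv) => [/orP[|]|[q qps vq]]; first by left.
    by rewrite hF // => hvs; right; exists (vs, p); rewrite ?mem_head.
  by right; exists q; rewrite // inE qps orbT.
case=> -[|[vs p] ps] [] //= [Ek] /andP[hp hps] h2 h3.
exists (fun v => v \in vs), (fun e => e \in p); split; first by apply/path_setsP; exists vs, p.
apply/(IH (fun v => U v || (v \in vs)) (fun e => W e || (e \in p))).
exists ps; split=> // v hv.
  case: (h2 v hv) => [->|[q]]; first by left.
  by rewrite inE => /predU1P[-> /= h|]; [left; rewrite h orbT | right; exists q].
case: (h3 v hv) => [->|[q]]; first by left.
by rewrite inE => /predU1P[-> /= h|]; [left; rewrite h orbT | right; exists q].
Qed.

Lemma pcover_union k : pcover k n es (fun _ => false) (fun _ => false) <->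
  union_of_paths H k.
Proof.
rewrite pcoverP; split=> -[ps]; last first.
  by case=> h1 [h2 [h3 h4]]; exists ps; split=> // v hv; right; auto.
by case=> h1 h2 h3 h4; exists ps; do 2 split=> //; split=> v hv;
  [case: (h3 v hv)|case: (h4 v hv)].
Qed.

Lemma crosses_iota i d e : e < m ->
  (sel d (dedge H e) \in take i (iota 0 n)) = (sel d (dedge H e) < i).
Proof.
move=> he; rewrite take_iota mem_iota /= add0n leq_min.
by rewrite (dg_wf_end d wfH he) andbT.
Qed.

Lemma down_prefix (X : nat -> bool) k :
  pairwise (fun x y => y ==> x) (map X (iota 0 k)) ->
  exists i, {in gtn k, X =1 gtn i}.
Proof.
rewrite pairwise_map => /(pairwiseP 0); rewrite size_iota => hp.
set i := find (predC X) (iota 0 k); exists i => j; rewrite !inE => hj.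
have [ji|ij] := ltnP j i.
  by have := before_find 0 ji; rewrite nth_iota // => /negbFE.
have ik : i < k := leq_ltn_trans ij hj.
have Xi : X i = false.
  apply/negbTE; have := nth_find 0 (a := predC X) (s := iota 0 k).
  by rewrite has_find size_iota nth_iota //; apply.
move: ij; rewrite leq_eqVlt => /predU1P[<- //|ij].
by have := hp i j ik hj ij; rewrite /= !nth_iota // !add0n Xi implybF => /negbTE.
Qed.

Lemma dpath_edges_uniq vs p : dpath H vs p -> uniq p.
Proof.
move=> /dpathP[h1 h2 h3 h4 h5]; apply/(uniqP 0) => i j; rewrite !inE => hi hj E.
have := h5 _ hi; rewrite E h5 // => -[/eqP + _].
by rewrite nth_uniq // ?h2 ?ltnS; [move/eqP | apply: ltnW | apply: ltnW].
Qed.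

Lemma crosses_iotaE i e : e < m -> crosses (iota 0 n) i (dedge H e) =
  (((dedge H e).1 < i) != ((dedge H e).2 < i)).
Proof.
by move=> he; rewrite /crosses (crosses_iota i true he) (crosses_iota i false he).
Qed.

(** A prefix of the natural order is a set [gtn i]. The list [p] and the set [F] give the same count
    of crossing edges because a simple path repeats no edge. *)
Lemma ztopological_iota z : ztopological H (iota 0 n) z <-> ~ zigzag_bad z n es.
Proof.
have Em : size es = m by rewrite size_map.
have Ei d e X : e < m -> einc es d e X = X (sel d (dedge H e)).
  by move=> he; apply: einc_Some.
split.
  move=> [_ hz] [V [F [X [G [/path_setsP[vs [p [hp hV hF]]] /down_prefix[i hi] hG hc]]]]].
  move: hc; rewrite ltnNge => /negP; apply; apply: leq_trans (hz vs p hp i).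
  rewrite -!size_filter Em; apply: uniq_leq_size; first exact/filter_uniq/iota_uniq.
  move=> e; rewrite !mem_filter mem_iota add0n => /andP[Ge /= he].
  rewrite Em in hG; have := hG e he Ge; rewrite !Ei // hF // => -[-> hX].
  rewrite andbT crosses_iotaE //; move: hX.
  rewrite !hi ?inE ?(dg_wf_end _ wfH he) // /sel.
  by case: (_ < i); case: (_ < i) => // -[].
move=> hb; split; first exact: perm_refl.
move=> vs p hp i; rewrite leqNgt; apply/negP => hc; apply: hb.
have [d1 d2 d3 d4 d5] := dpathP _ _ _ hp.
exists (fun v => v \in vs), (fun e => e \in p), (gtn i), (fun e => (e \in p) && crosses (iota 0 n) i (dedge H e)).
split; first by apply/path_setsP; exists vs, p.
- rewrite pairwise_map -(sorted_pairwise) => [|x y t].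
    apply: (sub_sorted _ (iota_ltn_sorted 0 n)) => x y /= xy; apply/implyP.
    exact: ltn_trans.
  by rewrite /= => /implyP a /implyP b; apply/implyP => /b/a.
- rewrite Em => e he /andP[ep]; rewrite !Ei // crosses_iotaE // /sel inE.
  by rewrite !inE; case: (_ < i); case: (_ < i) => // _; split=> // -[]; auto.
apply: leq_trans hc _; rewrite -!size_filter Em; apply: uniq_leq_size.
  exact/filter_uniq/(dpath_edges_uniq hp).
by move=> e; rewrite !mem_filter mem_iota => /andP[-> ep]; rewrite ep d4.
Qed.

End SpathDpath.

(** * Sentences and isomorphism *)

Lemma has_single (X p : nat -> bool) n v : v < n -> {in gtn n, X =1 pred1 v} ->
  has (fun i => X i && p i) (iota 0 n) = p v.
Proof.
move=> hv hX; rewrite -[RHS](has_pred1_iota p hv); apply: eq_in_has => i.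
by rewrite mem_iota => hi; rewrite hX.
Qed.

Section WsatMsat.
Variables (w : seq slice) (H : digraph) (wfH : dg_wf H).
Hypothesis (Ee : glue_edges w = map Some (de H)) (Ev : nverts w = dv H).
Let n := dv H.
Let m := size (de H).

(** Correspondence is asked only of variables in scope and only in range: the initial environments,
    empty sets on one side and the value 0 on the other, do not correspond, so closedness of the
    sentence enters here. *)
Lemma wsat_msat phi bv be bV bE ev ee sV sE A B : mso_scoped bv be bV bE phi ->
  {in bv, forall x, ev x < n /\ {in gtn n, A x.*2 =1 pred1 (ev x)}} ->
  {in be, forall e, ee e < m /\ {in gtn m, B e.*2 =1 pred1 (ee e)}} ->
  {in bV, forall X, {in gtn n, A X.*2.+1 =1 sV X}} ->
  {in bE, forall X, {in gtn m, B X.*2.+1 =1 sE X}} ->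
  wsat w A B phi <-> msat_env H ev ee sV sE phi.
Proof.
have Em : nedges w = m by rewrite /nedges Ee size_map.
have inc (A' B' : env) d e x b f : e < m -> {in gtn m, B' b =1 pred1 e} ->
    x < n -> {in gtn n, A' f =1 pred1 x} ->
    has (fun i => B' b i && einc (glue_edges w) d i (A' f)) (iota 0 (nedges w))
    <-> sel d (dedge H e) = x.
  move=> he hB hx hA; rewrite Em (has_single _ he) // Ee (einc_Some (0, 0)) //.
  by rewrite hA ?inE ?(dg_wf_end d wfH he) //=; split=> /eqP.
have upd_s k (C : env) (l : seq nat) (h : nat -> nat) x v : v < k ->
    {in l, forall y, h y < k /\ {in gtn k, C y.*2 =1 pred1 (h y)}} ->
    {in x :: l, forall y, upd h x v y < k /\
      {in gtn k, upd C x.*2 (pred1 v) y.*2 =1 pred1 (upd h x v y)}}.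
  move=> hv hl y; rewrite inE /upd (inj_eq double_inj).
  by case: eqP => //= _; apply: hl.
have upd_o k (C : env) (l : seq nat) (s : env) x S :
    {in l, forall X, {in gtn k, C X.*2.+1 =1 s X}} ->
    {in l, forall X, {in gtn k, upd C x.*2 S X.*2.+1 =1 s X}}.
  (* Element and set variables have indices of different parity, so an update of one kind leaves the
     other intact. *)
  by move=> hl X hX; rewrite /upd; case: eqP => [|_]; [lia | apply: hl].
have upd_S k (C : env) (l : seq nat) (s : env) x S :
    {in l, forall X, {in gtn k, C X.*2.+1 =1 s X}} ->
    {in x :: l, forall X, {in gtn k, upd C x.*2.+1 S X.*2.+1 =1 upd s x S X}}.
  move=> hl X; rewrite inE /upd eqSS (inj_eq double_inj).
  by case: eqP => //= _; apply: hl.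
have upd_o' k (C : env) (l : seq nat) (h : nat -> nat) x S :
    {in l, forall y, h y < k /\ {in gtn k, C y.*2 =1 pred1 (h y)}} ->
    {in l, forall y, h y < k /\ {in gtn k, upd C x.*2.+1 S y.*2 =1 pred1 (h y)}}.
  by move=> hl X hX; rewrite /upd; case: eqP => [|_]; [lia | apply: hl].
elim: phi bv be bV bE ev ee sV sE A B =>
  [x y|x y|e x|e x|x y|x y|p IH|p IHp q IHq|x p IH|x p IH|x p IH|x p IH]
  bv be bV bE ev ee sV sE A B /=.
- case/andP=> hx hy Hv He HV HE.
  have [ex ax] := Hv _ hx; have [ey ay] := Hv _ hy.
  by rewrite Ev (has_single _ ex) // ay //=; split=> [/eqP|/eqP].
- case/andP=> hx hy Hv He HV HE.
  have [ex ax] := He _ hx; have [ey ay] := He _ hy.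
  by rewrite Em (has_single _ ex) // ay //=; split=> [/eqP|/eqP].
- case/andP=> hx hy Hv He HV HE.
  by have [ex ax] := He _ hx; have [ey ay] := Hv _ hy; apply: (inc _ _ true).
- case/andP=> hx hy Hv He HV HE.
  by have [ex ax] := He _ hx; have [ey ay] := Hv _ hy; apply: (inc _ _ false).
- case/andP=> hx hy Hv He HV HE.
  by have [ex ax] := Hv _ hx; rewrite Ev (has_single _ ex) // (HV _ hy).
- case/andP=> hx hy Hv He HV HE.
  by have [ex ax] := He _ hx; rewrite Em (has_single _ ex) // (HE _ hy).
- by move=> hp Hv He HV HE; rewrite (IH _ _ _ _ ev ee sV sE _ _ hp).
- case/andP=> hp hq Hv He HV HE.
  by rewrite (IHp _ _ _ _ ev ee sV sE _ _ hp) // (IHq _ _ _ _ ev ee sV sE _ _ hq).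
- move=> hp Hv He HV HE; rewrite Ev; split=> -[v [hv hh]]; exists v; split=> //;
    move: hh; apply (IH _ _ _ _ _ _ _ _ _ _ hp); auto.
- move=> hp Hv He HV HE; rewrite Em; split=> -[v [hv hh]]; exists v; split=> //;
    move: hh; apply (IH _ _ _ _ _ _ _ _ _ _ hp); auto.
- by move=> hp Hv He HV HE; split=> -[S hh]; exists S; move: hh;
    apply (IH _ _ _ _ _ _ _ _ _ _ hp); auto.
- by move=> hp Hv He HV HE; split=> -[S hh]; exists S; move: hh;
    apply (IH _ _ _ _ _ _ _ _ _ _ hp); auto.
Qed.

Lemma wsat_sentence phi : mso_sentence phi ->
  wsat w (fun _ _ => false) (fun _ _ => false) phi <-> msat H phi.
Proof. by move=> h; apply: (wsat_msat h). Qed.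

End WsatMsat.

(** Formulas quantify over edge indices, so an explicit edge bijection is needed besides the vertex
    bijection named by [dg_iso]. Inverses are given so that sets can be transported in both
    directions. *)
Record diso (G H : digraph) (f f' g g' : nat -> nat) : Prop := Diso {
  iso_dv : dv G = dv H;
  iso_de : size (de G) = size (de H);
  iso_f : forall v, v < dv H -> [/\ f v < dv H, f' v < dv H, f' (f v) = v & f (f' v) = v];
  iso_g : forall e, e < size (de H) ->
    [/\ g e < size (de H), g' e < size (de H), g' (g e) = e & g (g' e) = e];
  iso_e : forall e, e < size (de H) ->
    dedge H (g e) = (f (dedge G e).1, f (dedge G e).2) }.

Lemma diso_sym G H f f' g g' : dg_wf G -> diso G H f f' g g' -> diso H G f' f g' g.
Proof.
move=> wG [h1 h2 h3 h4 h5]; split=> //; rewrite ?h1 ?h2.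
- by move=> v /h3[].
- by move=> v /h4[].
move=> e he; have [_ he' _ ee] := h4 e he; have := h5 _ he'; rewrite ee => -> /=.
rewrite -h2 in he'; have := dg_wf_end true wG he'; have := dg_wf_end false wG he'.
by rewrite h1 /sel => /h3[_ _ -> _] /h3[_ _ -> _]; case: dedge.
Qed.

Lemma perm_iota_cancel s n : perm_eq s (iota 0 n) -> forall i, i < n ->
  [/\ nth 0 s i < n, index i s < n, index (nth 0 s i) s = i & nth 0 s (index i s) = i].
Proof.
move=> hs i hi; have sz : size s = n by rewrite (perm_size hs) size_iota.
have us : uniq s by rewrite (perm_uniq hs) iota_uniq.
have ms j : (j \in s) = (j < n) by rewrite (perm_mem hs) mem_iota.
by split; rewrite -?ms ?mem_nth ?index_uniq ?nth_index ?ms ?sz // -sz index_mem ms.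
Qed.

(** The permutation of indices behind the [perm_eq] of the edge lists serves as edge bijection. *)
Lemma perm_diso G H om : dv G = dv H -> is_ordering G om ->
  perm_eq (map (relabel om) (de G)) (de H) ->
  exists g g', diso G H (nth 0 om) (index^~ om) g g'.
Proof.
move=> E ho hp; have sz := perm_size hp; rewrite size_map in sz.
have /(perm_iotaP (0, 0))[Is hI EI] := hp.
exists (nth 0 Is), (index^~ Is); split=> //.
- by apply: perm_iota_cancel; rewrite -E.
- by apply: perm_iota_cancel.
move=> e he; have sI : size Is = size (de H) by rewrite (perm_size hI) size_iota.
have : nth (0, 0) (map (relabel om) (de G)) e = nth (0, 0) (map (nth (0, 0) (de H)) Is) e.
  by rewrite EI.
by rewrite (nth_map (0, 0)) ?sz // (nth_map 0) ?sI // /dedge => <-.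
Qed.

Lemma dpath_iso G H f f' g g' vs p : diso G H f f' g g' ->
  dpath G vs p -> dpath H (map f vs) (map g p).
Proof.
move=> [h1 h2 h3 h4 h5] /dpathP[d1 d2 d3 d4 d5]; rewrite h1 h2 in d3 d4.
apply/dpathP; split.
- rewrite map_inj_in_uniq // => x y /d3/h3[_ _ a _] /d3/h3[_ _ b _] E.
  by rewrite -a E b.
- by rewrite !size_map.
- by move=> _ /mapP[v /d3/h3[hv _ _ _] ->].
- by move=> _ /mapP[v /d4/h4[hv _ _ _] ->].
move=> j; rewrite size_map => hj.
have hj' := ltnW hj; rewrite !(nth_map 0) ?d2 //.
by rewrite h5 ?d5 // d4 // mem_nth.
Qed.

Lemma union_iso G H f f' g g' k : diso G H f f' g g' ->
  union_of_paths G k -> union_of_paths H k.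
Proof.
move=> hi [ps [<- [hp [hv he]]]]; have [h1 h2 h3 h4 h5] := hi.
exists [seq (map f p.1, map g p.2) | p <- ps]; rewrite size_map; split=> //; split.
  by rewrite all_map; apply: sub_all hp => p /=; apply: dpath_iso hi.
split=> x hx.
  have [_ x1 _ x2] := h3 x hx; rewrite -h1 in x1; have [p pp xp] := hv _ x1.
  exists (map f p.1, map g p.2); first by apply/mapP; exists p.
  by rewrite -x2 /= map_f.
have [_ x1 _ x2] := h4 x hx; rewrite -h2 in x1; have [p pp xp] := he _ x1.
exists (map f p.1, map g p.2); first by apply/mapP; exists p.
by rewrite -x2 /= map_f.
Qed.

Lemma msat_iso_env G H f f' g g' phi bv be bV bE ev ee sV sE ev' ee' sV' sE' :
  dg_wf G -> diso G H f f' g g' -> mso_scoped bv be bV bE phi ->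
  {in bv, forall x, ev x < dv H /\ ev' x = f (ev x)} ->
  {in be, forall x, ee x < size (de H) /\ ee' x = g (ee x)} ->
  {in bV, forall X, forall v, v < dv H -> sV X v = sV' X (f v)} ->
  {in bE, forall X, forall v, v < size (de H) -> sE X v = sE' X (g v)} ->
  msat_env G ev ee sV sE phi <-> msat_env H ev' ee' sV' sE' phi.
Proof.
move=> wG [h1 h2 h3 h4 h5].
have updf k (l : seq nat) (h s s' : nat -> nat) x v : v < k ->
    {in l, forall y, s y < k /\ s' y = h (s y)} ->
    {in x :: l, forall y, upd s x v y < k /\ upd s' x (h v) y = h (upd s x v y)}.
  by move=> hv hl y; rewrite inE /upd; case: eqP => //= _; apply: hl.
have updS k (l : seq nat) (h : nat -> nat) (s s' : env) x S S' :
    (forall v, v < k -> S v = S' (h v)) ->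
    {in l, forall X, forall v, v < k -> s X v = s' X (h v)} ->
    {in x :: l, forall X, forall v, v < k -> upd s x S X v = upd s' x S' X (h v)}.
  by move=> hv hl y; rewrite inE /upd; case: eqP => //= _; apply: hl.
have finj v u : v < dv H -> u < dv H -> f v = f u -> v = u.
  by move=> /h3[_ _ a _] /h3[_ _ b _] E; rewrite -a E b.
have ginj v u : v < size (de H) -> u < size (de H) -> g v = g u -> v = u.
  by move=> /h4[_ _ a _] /h4[_ _ b _] E; rewrite -a E b.
have ends d e : e < size (de H) -> sel d (dedge G e) < dv H.
  by rewrite -h1 -h2; apply: dg_wf_end.
elim: phi bv be bV bE ev ee sV sE ev' ee' sV' sE' =>
  [x y|x y|e x|e x|x y|x y|p IH|p IHp q IHq|x p IH|x p IH|x p IH|x p IH]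
  bv be bV bE ev ee sV sE ev' ee' sV' sE' /=.
- case/andP=> /[swap] hy /[swap] Hv /Hv [ex ->] He HV HE; have [ey ->] := Hv _ hy.
  by split=> [->|/finj] //; apply.
- case/andP=> hx hy Hv He HV HE; have [ex ->] := He _ hx; have [ey ->] := He _ hy.
  by split=> [->|/ginj] //; apply.
- case/andP=> hx hy Hv He HV HE; have [ex ->] := He _ hx; have [ey ->] := Hv _ hy.
  by rewrite h5 //=; split=> [->|/finj] //; apply=> //; apply: (ends true).
- case/andP=> hx hy Hv He HV HE; have [ex ->] := He _ hx; have [ey ->] := Hv _ hy.
  by rewrite h5 //=; split=> [->|/finj] //; apply=> //; apply: (ends false).
- case/andP=> hx hy Hv He HV HE; have [ex ->] := Hv _ hx; by rewrite (HV _ hy).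
- case/andP=> hx hy Hv He HV HE; have [ex ->] := He _ hx; by rewrite (HE _ hy).
- by move=> hp Hv He HV HE; rewrite (IH _ _ _ _ ev ee sV sE ev' ee' sV' sE' hp).
- case/andP=> hp hq Hv He HV HE.
  by rewrite (IHp _ _ _ _ ev ee sV sE ev' ee' sV' sE' hp) //
             (IHq _ _ _ _ ev ee sV sE ev' ee' sV' sE' hq).
- move=> hp Hv He HV HE; rewrite h1; split=> -[v [hv hh]]; have [v1 v2 v3 v4] := h3 v hv.
    exists (f v); split=> //; move: hh; apply (IH _ _ _ _ _ _ _ _ _ _ _ _ hp); auto.
  exists (f' v); split=> //; move: hh; rewrite -{1}v4.
  apply (IH _ _ _ _ _ _ _ _ _ _ _ _ hp); auto.
- move=> hp Hv He HV HE; rewrite h2; split=> -[v [hv hh]]; have [v1 v2 v3 v4] := h4 v hv.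
    exists (g v); split=> //; move: hh; apply (IH _ _ _ _ _ _ _ _ _ _ _ _ hp); auto.
  exists (g' v); split=> //; move: hh; rewrite -{1}v4.
  apply (IH _ _ _ _ _ _ _ _ _ _ _ _ hp); auto.
- move=> hp Hv He HV HE; split=> -[S hh].
    (* A set of vertices of [G] becomes one of [H] by taking preimages under the inverse map. *)
    exists (fun v => S (f' v)); move: hh; apply (IH _ _ _ _ _ _ _ _ _ _ _ _ hp); auto.
    by apply: updS => // v /h3[_ _ -> _].
  exists (fun v => S (f v)); move: hh; apply (IH _ _ _ _ _ _ _ _ _ _ _ _ hp); auto.
- move=> hp Hv He HV HE; split=> -[S hh].
    exists (fun v => S (g' v)); move: hh; apply (IH _ _ _ _ _ _ _ _ _ _ _ _ hp); auto.
    by apply: updS => // v /h4[_ _ -> _].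
  exists (fun v => S (g v)); move: hh; apply (IH _ _ _ _ _ _ _ _ _ _ _ _ hp); auto.
Qed.

Lemma msat_iso G H f f' g g' phi : dg_wf G -> diso G H f f' g g' ->
  mso_sentence phi -> msat G phi <-> msat H phi.
Proof. by move=> wG hi hp; apply: (msat_iso_env wG hi hp). Qed.

(** The map [nth 0 om] sends the vertices below [i] exactly to [take i om], so corresponding paths
    cross corresponding cuts equally often. *)
Lemma ztopological_iso G H om f' g g' z : dg_wf G -> is_ordering G om ->
  diso G H (nth 0 om) f' g g' ->
  ztopological G (iota 0 (dv G)) z <-> ztopological H om z.
Proof.
move=> wG ho hi; have [h1 h2 h3 h4 h5] := hi.
have us : uniq om by rewrite (perm_uniq ho) iota_uniq.
have sz : size om = dv G by rewrite (perm_size ho) size_iota.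
have tk v i : v < dv G -> (nth 0 om v \in take i om) = (v < i).
  move=> hv; have [hi'|hi'] := leqP (size om) i.
    by rewrite take_oversize // mem_nth ?sz // (leq_trans _ hi') // sz.
  by rewrite in_take ?mem_nth ?sz // index_uniq // sz.
have cr e i : e < size (de G) ->
    crosses om i (dedge H (g e)) = crosses (iota 0 (dv G)) i (dedge G e).
  move=> he; rewrite crosses_iotaE // h5 -?h2 // /crosses /= !tk //.
    exact: (dg_wf_end false).
  exact: (dg_wf_end true).
split=> -[_ hz]; split; [by rewrite /is_ordering -h1 | |exact: perm_refl|].
  move=> vs p hp i; have hp' := dpath_iso (diso_sym wG hi) hp.
  apply: leq_trans (hz _ _ hp' i); rewrite count_map.
  apply: eq_leq; apply: eq_in_count => e.
  have [_ _ _ d4 _] := dpathP _ _ _ hp => /d4/h4[_ e1 _ e2] /=.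
  by rewrite -{1}e2 cr // h2.
move=> vs p hp i; have hp' := dpath_iso hi hp.
apply: leq_trans (hz _ _ hp' i); rewrite count_map.
apply: eq_leq; apply: eq_in_count => e.
by have [_ _ _ d4 _] := dpathP _ _ _ hp => /d4 he /=; rewrite cr.
Qed.

(** * Slices up to equivalence *)

Lemma incident_valid S v e : is_slice S -> e \in s_edges S -> incident v e ->
  valid_sv S v.
Proof.
by move=> hS /(slice_edge_valid hS)[h1 h2] /orP[] /eqP <-.
Qed.

Lemma slice_count_front S v : is_slice S -> v.1 != 1 ->
  count (incident v) (s_edges S) = valid_sv S v.
Proof.
move=> hS; case: (boolP (valid_sv S v)) => hv nv.
  case/and5P: hS => _ _ _ /allP h0 /allP h2; move: hv nv; rewrite /valid_sv.
  case: v => [[|[|[|?]]] m] //= hm _; apply/eqP; [exact: h0|exact: h2].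
apply/eqP; rewrite -leqn0 leqNgt -has_count; apply/hasPn => e he.
by apply: contra hv; apply: incident_valid.
Qed.

Lemma edge_at_some S v : is_slice S -> v.1 != 1 -> valid_sv S v ->
  exists2 e, edge_at S v = Some e & e \in s_edges S /\ incident v e.
Proof.
move=> hS nv hv; have := slice_count_front hS nv; rewrite hv /edge_at -size_filter.
case E: [seq _ <- _ | _] => [|e s] //= _; exists e => //.
have : e \in [seq e <- s_edges S | incident v e] by rewrite E mem_head.
by rewrite mem_filter => /andP[].
Qed.

Lemma other_in S e n : is_slice S -> e \in s_edges S -> incident (0, n) e ->
  (other e (0, n)).1 = 1 \/ (other e (0, n)).1 = 2 /\ (other e (0, n)).2 \in s_out S.
Proof.
move=> hS he; case/and5P: (hS) => _ _ /allP /(_ e he) /and4P[+ + + _] _ _.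
rewrite /incident /other /valid_sv; case: e he => [[[t1 t2] [h1 h2]] o] _ /=.
rewrite !xpair_eqE; case: t1 => [|[|[|t1]]]; case: h1 => [|[|[|h1]]] //=;
  rewrite ?orbF; auto; do ?[case: eqP => //=; auto].
Qed.

(** Gluability hands a strand on from slice to slice, no edge returns to the in-frontier, and the
    last slice has no out-frontier; the strand must stop at a center. *)
Lemma trace_some S r n : path gluable S r -> all is_slice (S :: r) ->
  s_out (last S r) = [::] -> n \in s_in S -> trace (S :: r) n != None.
Proof.
elim: r S n => [|T r IH] S n /=.
  rewrite andbT => _ hS o0 hn.
  have [//|//|e -> [es ei]] := edge_at_some (v := (0, n)) hS.
  have [->//|[_]] := other_in hS es ei.
  by rewrite o0.
case/andP=> /andP[pST _] hp /andP[hS hr] o0 hn.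
have [//|//|e -> [es ei]] := edge_at_some (v := (0, n)) hS.
have [->//|[-> /= hu]] := other_in hS es ei.
have := IH T (other e (0, n)).2 hp hr o0; rewrite -(perm_mem pST) => /(_ hu) /=.
by case: (if edge_at T _ is Some _ then _ else _).
Qed.

Lemma glue_edges_some S r : path gluable S r -> all is_slice (S :: r) ->
  s_out (last S r) = [::] -> all (fun o => o != None) (glue_edges (S :: r)).
Proof.
elim: r S => [|T r IH] S hp hs o0; rewrite glue_edges_cons all_cat !all_map.
  rewrite andbT; apply/allP => e; rewrite mem_filter => /andP[eb es].
  have hS : is_slice S by case/andP: hs.
  have [] := slice_edge_valid hS es.
  move: eb; rewrite /born /valid_sv /bedge /vend /= o0.
  by case: e {es} => [[[t1 t2] [h1 h2]] o] /=;
     case: t1 => [|[|[|t1]]]; case: h1 => [|[|[|h1]]].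
move: (hp) (hs) => /= /andP[pST hp'] /andP[hS hs'].
apply/andP; split; last first.
  by apply: sub_all (IH T hp' hs' o0) => -[].
apply/allP => e; rewrite mem_filter => /andP[eb es].
have [] := slice_edge_valid hS es.
have ts m : m \in s_out S -> trace (T :: r) m != None.
  by case/andP: pST => /perm_mem -> _; apply: trace_some.
move: eb; rewrite /born /valid_sv /bedge /vend [preim _ _ _]/=; move: ts.
case: e {es} => [[[t1 t2] [h1 h2]] o]; rewrite ![(_, _).1]/= ![(_, _).2]/= => ts.
by case: t1 => [|[|[|t1]]]; case: h1 => [|[|[|h1]]] //= _ u v;
  [move: (ts _ v) | move: (ts _ u)] => /=;
  case: (if edge_at T _ is Some _ then _ else _).
Qed.

Lemma vend_lt S r u x : is_slice S -> valid_sv S u -> u.1 != 0 ->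
  (forall p, trace r u.2 = Some p -> vidx r p.1 p.2 < nverts r) ->
  vend (s_nc S) r u = Some x -> x < nverts (S :: r).
Proof.
move=> hS hv nu hr; rewrite /vend nverts_cons; case: eqP => [u1|_].
  by move=> [<-]; move: hv; rewrite /valid_sv u1 => /ltn_addr ->.
case: trace hr => //= p /(_ p erefl) h [<-].
by rewrite ltn_add2l.
Qed.

Lemma trace_lt w n p : all is_slice w -> trace w n = Some p ->
  vidx w p.1 p.2 < nverts w.
Proof.
elim: w n p => [|S r IH] n p // /andP[hS hr] ht.
have := trace_vend S r n; rewrite ht; case E: edge_at => [e|] //=.
case: ifP => // hu hx; apply: (@vend_lt S r (other e (0, n))) (esym hx) => //.
- exact: slice_other_valid (proj1 (edge_at_mem E)).
- by case/orP: hu => /eqP->.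
- by move=> q; apply: IH.
Qed.

Lemma glue_edges_lt w p : all is_slice w -> Some p \in glue_edges w ->
  (p.1 < nverts w) && (p.2 < nverts w).
Proof.
elim: w p => [|S r IH] p //= /andP[hS hr].
rewrite glue_edges_cons mem_cat => /orP[/mapP[e]|/mapP[[q|] //]]; last first.
  by move=> /(IH _ hr) /andP[h1 h2] [->]; rewrite nverts_cons /= !ltn_add2l h1.
rewrite mem_filter => /andP[eb es]; have [v1 v2] := slice_edge_valid hS es.
have [n1 n2] : e.1.1.1 != 0 /\ e.1.2.1 != 0.
  by have := born_valid true eb; have := born_valid false eb; rewrite /sel => -[] -> [] ->.
rewrite /bedge; case E1: vend => [x|] //; case E2: vend => [y|] //= [->] /=.
by rewrite (vend_lt hS v1 n1 _ E1) ?(vend_lt hS v2 n2 _ E2) // => q; apply: trace_lt.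
Qed.

Lemma glue_wf w : all is_slice w -> dg_wf (glue w).
Proof.
move=> hw; apply/allP => p; rewrite mem_pmap map_id => hp.
exact: glue_edges_lt hw hp.
Qed.

Lemma glue_edgesE w : all (fun o => o != None) (glue_edges w) ->
  glue_edges w = map Some (de (glue w)).
Proof. by rewrite /=; elim: (glue_edges w) => //= -[p|] //= s IH /IH {1}->. Qed.

Lemma slice_equiv_sym S T : slice_equiv S T -> slice_equiv T S.
Proof.
by move=> [h1 [h2 [h3 h4]]]; do !split=> //; rewrite perm_sym.
Qed.

(** [edge_at] picks the first incident edge, a choice that depends on the list order in general;
    away from the centers there is at most one candidate. *)
Lemma edge_at_equiv S T v : is_slice S -> slice_equiv S T -> v.1 != 1 ->
  edge_at S v = edge_at T v.
Proof.
move=> hS [_ [_ [_ hE]]] nv; rewrite /edge_at; congr ohead.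
apply: perm_small_eq; last exact: perm_filter.
by rewrite size_filter -(permP hE) slice_count_front // leq_b1.
Qed.

Lemma slice_equiv_valid S T v : slice_equiv S T -> valid_sv S v = valid_sv T v.
Proof.
by move=> [h1 [/perm_mem h2 [/perm_mem h3 _]]]; rewrite /valid_sv h1 h2 h3.
Qed.

Lemma slice_equiv_slice S T : slice_equiv S T -> is_slice S -> is_slice T.
Proof.
move=> E; have [h1 [h2 [h3 h4]]] := E; rewrite /is_slice.
rewrite -(perm_uniq h2) -(perm_uniq h3) => /and5P[-> -> /= H1 H2 H3].
apply/and3P; split.
- rewrite -(perm_all _ h4); apply: sub_all H1 => e.
  by rewrite !(slice_equiv_valid _ E).
- by rewrite -(perm_all _ h2); apply: sub_all H2 => n; rewrite (permP h4).
- by rewrite -(perm_all _ h3); apply: sub_all H3 => n; rewrite (permP h4).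
Qed.

Lemma slice_equiv_alphabet c S T : slice_equiv S T ->
  in_alphabet c S -> in_alphabet c T.
Proof.
move=> E; have [h1 [h2 [h3 h4]]] := E.
rewrite /in_alphabet /unit_slice /swidth => /and3P[/andP[hS]].
rewrite h1 (perm_size h2) (perm_size h3) (slice_equiv_slice E hS) => -> -> /=.
by rewrite !all_cat (perm_all _ h2) (perm_all _ h3).
Qed.

Lemma gluable_equiv S S' T T' : is_slice S -> is_slice T ->
  slice_equiv S S' -> slice_equiv T T' -> gluable S T -> gluable S' T'.
Proof.
move=> hS hT eS eT /andP[hp ha]; have [_ [_ [oS _]]] := eS; have [_ [iT _]] := eT.
apply/andP; split.
  by rewrite -(permPl oS) -(permPr iT).
rewrite -(perm_all _ oS); apply: sub_all ha => n.
by rewrite (edge_at_equiv hS eS) // (edge_at_equiv hT eT).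
Qed.

Fixpoint word_equiv (w w' : seq slice) : Prop :=
  match w, w' with
  | T :: r, T' :: r' => slice_equiv T T' /\ word_equiv r r'
  | [::], [::] => True
  | _, _ => False
  end.

Lemma word_equivP w w' : word_equiv w w' <-> size w = size w' /\
  forall i, i < size w' -> slice_equiv (nth slice0 w i) (nth slice0 w' i).
Proof.
elim: w w' => [|S r IH] [|S' r'] /=; try by split=> [|[]].
split=> [[h /IH[h1 h2]]|[[h1] h2]].
  by split=> [|[|i] //]; [rewrite h1|apply: h2].
split; first exact: (h2 0).
by apply/IH; split=> // i hi; apply: (h2 i.+1).
Qed.

Lemma word_equiv_sym w w' : word_equiv w w' -> word_equiv w' w.
Proof.
elim: w w' => [|S r IH] [|S' r'] //= [/slice_equiv_sym h /IH h']; by split.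
Qed.

Lemma word_equiv_nc w w' : word_equiv w w' -> map s_nc w = map s_nc w'.
Proof. by elim: w w' => [|S r IH] [|S' r'] //= [[-> _] /IH ->]. Qed.

Lemma word_equiv_trace w w' n : all is_slice w -> word_equiv w w' -> trace w n = trace w' n.
Proof.
elim: w w' n => [|S r IH] [|S' r'] n //= /andP[hS hr] [h h'].
rewrite (edge_at_equiv hS h) //; case: edge_at => // e.
by rewrite (IH _ _ hr h').
Qed.

Lemma word_equiv_glue_edges w w' : all is_slice w -> word_equiv w w' ->
  perm_eq (glue_edges w) (glue_edges w').
Proof.
elim: w w' => [|S r IH] [|S' r'] //= /andP[hS hr] [h h'].
have [h1 [h2 [h3 h4]]] := h; rewrite !glue_edges_cons -h1; apply: perm_cat.
  have -> : map (bedge (s_nc S) r) (bedges S) = map (bedge (s_nc S) r') (bedges S).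
    apply: eq_map => e; rewrite /bedge /vend !(word_equiv_trace _ hr h').
    have E p : vidx r p.1 p.2 = vidx r' p.1 p.2.
      by rewrite /vidx !map_take (word_equiv_nc h').
    by case: trace => [p|]; case: trace => [q|]; rewrite /= ?E.
  by apply: perm_map; apply: perm_filter.
by apply: perm_map; apply: IH.
Qed.

Lemma word_equiv_slice w w' : word_equiv w w' -> all is_slice w -> all is_slice w'.
Proof.
elim: w w' => [|S r IH] [|S' r'] //= [h h'] /andP[/(slice_equiv_slice h) -> /=].
exact: IH.
Qed.

Lemma word_equiv_alphabet c w w' : word_equiv w w' -> all (in_alphabet c) w -> all (in_alphabet c) w'.
Proof.
elim: w w' => [|S r IH] [|S' r'] //= [h h'] /andP[/(slice_equiv_alphabet h) -> /=].
exact: IH.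
Qed.

Lemma word_equiv_path S S' r r' : all is_slice (S :: r) -> word_equiv (S :: r) (S' :: r') ->
  path gluable S r -> path gluable S' r'.
Proof.
elim: r S S' r' => [|T r IH] S S' [|T' r'] //=; first by move=> _ [_].
case/andP=> hS hr [h hT] /andP[g p]; have [h' _] := hT.
case/andP: (hr) => hT' _.
by rewrite (gluable_equiv hS hT' h h' g) (IH T T').
Qed.

Lemma word_okP S r : reflect [/\ all is_slice (S :: r), s_in S = [::],
    s_out (last S r) = [::] & path gluable S r] (word_ok (S :: r)).
Proof.
apply: (iffP and5P) => [[_ h1 /eqP h2 /eqP h3 /andP[h4 _]]|[h1 h2 h3 h4]].
  by split.
split=> //; first exact/eqP; first exact/eqP.
by rewrite h4; apply: glue_edges_some.
Qed.

Lemma word_equiv_word_ok w w' : word_equiv w w' -> word_ok w -> word_ok w'.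
Proof.
case: w w' => [|S r] [|S' r'] // h /word_okP[h1 h2 h3 h4]; apply/word_okP; split.
- exact: word_equiv_slice h h1.
- by case: h => [[_ [+ _]] _]; rewrite h2 perm_sym => /perm_nilP.
- elim: r r' S S' h h3 {h1 h2 h4} => [|T r IH] [|T' r'] S S' [h h'] //=.
    by move=> h3; case: h => [_ [_ [+ _]]]; rewrite h3 perm_sym => /perm_nilP.
  exact: IH.
- exact: word_equiv_path h h4.
Qed.

(** The vertex part is the identity, written through the trivial ordering to suit
    [ztopological_iso]; only the edges are renumbered. *)
Lemma word_equiv_diso w w' : all is_slice w -> word_equiv w w' ->
  exists g g', diso (glue w) (glue w') (nth 0 (iota 0 (dv (glue w))))
     (index^~ (iota 0 (dv (glue w)))) g g'.
Proof.
move=> hs h; apply: perm_diso; first by rewrite /= (word_equiv_nc h).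
  exact: perm_refl.
rewrite (@eq_in_map _ _ _ id _).1 ?map_id; last first.
  move=> [x y] /(allP (glue_wf hs)) /andP[/= hx hy].
  by rewrite /relabel /= !nth_iota.
by apply: perm_pmap; apply: word_equiv_glue_edges.
Qed.

(** * From an automaton to a slice graph *)

Section Letters.
Variable c : nat.

(* An edge of a loop-free slice meets a frontier vertex, which has degree one,
   so edges are not repeated and a finite set of them suffices. *)
Definition lvtx : finType := ('I_3 * 'I_c.+1)%type.
Definition ledge : finType := ((lvtx * lvtx) * bool)%type.
Definition letter : finType :=
  (bool * {set 'I_c.+1} * {set 'I_c.+1} * {set ledge})%type.

Definition sv_of (v : lvtx) : svtx := (val v.1, val v.2).
Definition se_of (e : ledge) : sedge := ((sv_of e.1.1, sv_of e.1.2), e.2).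

Definition slice_of (l : letter) : slice :=
  Slice l.1.1.1 (map val (enum l.1.1.2)) (map val (enum l.1.2))
    (map se_of (enum l.2)).

Definition letter_of (S : slice) : letter :=
  (s_nc S == 1, [set i : 'I_c.+1 | val i \in s_in S],
   [set i : 'I_c.+1 | val i \in s_out S], [set e | se_of e \in s_edges S]).

Definition loopfree (S : slice) : bool :=
  all (fun e : sedge => ~~ ((e.1.1.1 == 1) && (e.1.2.1 == 1))) (s_edges S).

Lemma se_of_inj : injective se_of.
Proof.
move=> [[[t1 t2] [h1 h2]] o] [[[t1' t2'] [h1' h2']] o'] [].
by move=> /val_inj-> /val_inj-> /val_inj-> /val_inj-> ->.
Qed.

Lemma valid_sv_of S v : in_alphabet c S -> valid_sv S v ->
  exists u, v = sv_of u.
Proof.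
rewrite /in_alphabet /unit_slice => /and3P[/andP[_ h1] _ /allP ha] hv.
have h1' : v.1 < 3 by move: hv; rewrite /valid_sv; case: (v.1) => [|[|[|]]].
have h2' : v.2 < c.+1.
  move: hv (ha v.2); rewrite /valid_sv mem_cat.
  case: (v.1) => [|[|[|]]] //; [move=> -> /(_ isT) /andP[] //| |].
    by move=> h _; apply: leq_trans (ltn0Sn c); lia.
  by move=> ->; rewrite orbT => /(_ isT) /andP[].
by exists (Ordinal h1', Ordinal h2'); rewrite [LHS]surjective_pairing.
Qed.

Lemma slice_edges_uniq S : is_slice S -> loopfree S -> uniq (s_edges S).
Proof.
move=> hS /allP lS; apply: count_mem_uniq => e.
case: (boolP (e \in _)) => he; last exact/count_memPn.
have [v nv iv] : exists2 v : svtx, v.1 != 1 & incident v e.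
  have := lS e he; rewrite negb_and => /orP[] h; [exists e.1.1 | exists e.1.2];
  by rewrite // /incident eqxx ?orbT.
apply/eqP; rewrite eqn_leq -has_count has_pred1 he andbT.
apply: (@leq_trans (count (incident v) (s_edges S))).
  by apply: sub_count => f /= /eqP->.
by rewrite slice_count_front // leq_b1.
Qed.

Lemma slice_of_letter S : in_alphabet c S -> loopfree S ->
  slice_equiv (slice_of (letter_of S)) S.
Proof.
move=> hS lS; have sS := alphabet_slice hS.
have [u1 u2] : uniq (s_in S) /\ uniq (s_out S) by case/and5P: sS.
move: (hS); rewrite /in_alphabet /unit_slice => /and3P[/andP[_ n1] _ /allP ha].
have bnd x : x \in s_in S ++ s_out S -> x < c.+1 by move/ha/andP=> [].
do !split.
- by rewrite /=; case: (s_nc S) n1 => [|[|]].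
- apply: uniq_perm => //; first by rewrite map_inj_uniq ?enum_uniq //; apply: val_inj.
  move=> x; apply/mapP/idP => [[i]|hx]; first by rewrite mem_enum inE => h ->.
  have hx' : x < c.+1 by rewrite bnd // mem_cat hx.
  by exists (Ordinal hx') => //; rewrite mem_enum inE.
- apply: uniq_perm => //; first by rewrite map_inj_uniq ?enum_uniq //; apply: val_inj.
  move=> x; apply/mapP/idP => [[i]|hx]; first by rewrite mem_enum inE => h ->.
  have hx' : x < c.+1 by rewrite bnd // mem_cat hx orbT.
  by exists (Ordinal hx') => //; rewrite mem_enum inE.
apply: uniq_perm.
- by rewrite map_inj_uniq ?enum_uniq //; apply: se_of_inj.
- exact: slice_edges_uniq.
move=> e; apply/mapP/idP => [[i]|he]; first by rewrite mem_enum inE => h ->.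
have [/(valid_sv_of hS)[t ht] /(valid_sv_of hS)[h hh]] := slice_edge_valid sS he.
have E : e = se_of ((t, h), e.2) by rewrite /se_of /= -ht -hh; case: (e) => [[]].
by exists ((t, h), e.2) => //; rewrite mem_enum inE -E.
Qed.

(** Letters that decode to no slice of the alphabet get the empty slice, so that every vertex of the
    slice graph has a legal label. *)
Definition lab (l : letter) : slice :=
  if in_alphabet c (slice_of l) then slice_of l else slice0.

Lemma lab_alphabet l : in_alphabet c (lab l).
Proof. by rewrite /lab; case: ifP. Qed.

Lemma lab_letter_of S : in_alphabet c S -> loopfree S ->
  slice_equiv (lab (letter_of S)) S.
Proof.
move=> hS lS; have E := slice_of_letter hS lS.
by rewrite /lab (slice_equiv_alphabet (slice_equiv_sym E) hS).
Qed.

End Letters.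

Section SliceGraph.
Variables (c : nat) (D : dfa).

Let V : finType := (letter c * dst D)%type.
Let noenv : env := fun _ _ => false.
Let runw (w : seq slice) : dst D := run D w noenv noenv.

Definition vlab (x : V) : slice := lab x.1.
Definition sgv0 : V := (letter_of c slice0, d0 D).
Definition sgarc (x y : V) : bool :=
  gluable (vlab x) (vlab y) && (x.2 == dstep (vlab x) noenv noenv y.2).
Definition sginit (x : V) : bool := (s_in (vlab x) == [::]) && dacc x.2.
Definition sgfinal (x : V) : bool :=
  (s_out (vlab x) == [::]) && (x.2 == dstep (vlab x) noenv noenv (d0 D)).

Definition sgenc (x : V) : nat := index x (enum V).
Definition sgdec (i : nat) : V := nth sgv0 (enum V) i.

(* A vertex carries a letter and the state reached on the suffix that starts
   with this letter; arcs guess that state from left to right. *)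
Definition dfa_graph : slice_graph :=
  SliceGraph (size (enum V)) (fun i => vlab (sgdec i))
    [seq (sgenc p.1, sgenc p.2) | p <- enum {: V * V} & sgarc p.1 p.2]
    [seq sgenc x | x <- enum V & sginit x]
    [seq sgenc x | x <- enum V & sgfinal x].

Lemma sgencK : cancel sgenc sgdec.
Proof. by move=> x; rewrite /sgdec nth_index // mem_enum. Qed.

Lemma sgenc_lt x : sgenc x < size (enum V).
Proof. by rewrite index_mem mem_enum. Qed.

Lemma sg_arcsP i j : (i, j) \in sg_arcs dfa_graph ->
  [/\ i < sg_n dfa_graph, j < sg_n dfa_graph & sgarc (sgdec i) (sgdec j)].
Proof.
case/mapP=> [[x y]]; rewrite mem_filter /= => /andP[h _] [-> ->].
by rewrite !sgencK !sgenc_lt.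
Qed.

Lemma sg_initP i : i \in sg_init dfa_graph ->
  i < sg_n dfa_graph /\ sginit (sgdec i).
Proof.
by case/mapP=> x; rewrite mem_filter => /andP[h _] ->; rewrite sgencK sgenc_lt.
Qed.

Lemma sg_finalP i : i \in sg_final dfa_graph ->
  i < sg_n dfa_graph /\ sgfinal (sgdec i).
Proof.
by case/mapP=> x; rewrite mem_filter => /andP[h _] ->; rewrite sgencK sgenc_lt.
Qed.

Lemma dfa_graph_wf : sg_wf c dfa_graph.
Proof.
split; first by move=> [i j] /sg_arcsP[].
split; first by move=> v /sg_initP[h /andP[/eqP]].
split; first by move=> v /sg_finalP[h /andP[/eqP]].
split; first by move=> v _; apply: lab_alphabet.
by move=> [i j] /sg_arcsP[_ _ /andP[]].
Qed.

(** A final vertex carries the state after its own letter, and each arc determines the state on its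
    left from the one on its right, so all guessed states are correct. *)
Lemma run_states x xs : path sgarc x xs -> sgfinal (last x xs) ->
  path gluable (vlab x) (map vlab xs) /\ runw (map vlab (x :: xs)) = x.2.
Proof.
elim: xs x => [|y xs IH] x /=; first by move=> _ /andP[_ /eqP->].
case/andP=> /andP[g /eqP E] hp hf; have [h1 h2] := IH y hp hf.
by rewrite g h1 E -h2.
Qed.

Fixpoint states (ls : seq (letter c)) : seq V :=
  if ls is l :: r then (l, runw (map (@lab c) ls)) :: states r else [::].

Lemma states_lab ls : map vlab (states ls) = map (@lab c) ls.
Proof. by elim: ls => //= l r ->. Qed.

Lemma path_states l ls : path gluable (lab l) (map (@lab c) ls) ->
  path sgarc (l, runw (map (@lab c) (l :: ls))) (states ls).
Proof.
elim: ls l => [|l' ls IH] l //= /andP[g hp].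
by rewrite IH // andbT /sgarc g /=.
Qed.

(** Walks match [w] only up to [slice_equiv], so acceptance is a statement about the word of labels
    and not about [w] itself. *)
Lemma in_lang_dfa w : in_lang dfa_graph w <-> exists l ls,
  [/\ word_equiv (map (@lab c) (l :: ls)) w, word_ok (map (@lab c) (l :: ls))
    & dacc (run D (map (@lab c) (l :: ls)) noenv noenv)].
Proof.
have labs ls : all is_slice (map (@lab c) ls).
  by rewrite all_map; apply/allP => l _; apply: alphabet_slice (lab_alphabet l).
split.
  case=> -[|v vs] [[// _ hs hi hf] [harc hlab]]; rewrite /= in hs hi hf.
  set x := sgdec v; set xs := map sgdec vs.
  have hp : path sgarc x xs.
    apply/(pathP sgv0) => i; rewrite size_map => hi'.
    have := harc i hi'; rewrite -[x :: xs]/(map sgdec (v :: vs)).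
    by rewrite !(nth_map 0) // => [/sg_arcsP[]|]; last exact: ltnW.
  have hl : sgfinal (last x xs) by rewrite last_map; case/sg_finalP: hf.
  have [hg hr] := run_states hp hl.
  suff H w' : w' = map vlab (x :: xs) ->
      [/\ word_equiv w' w, word_ok w' & dacc (run D w' noenv noenv)].
    by exists x.1, (map fst xs); apply: H; rewrite /= -map_comp.
  move=> ->; split.
  - apply/word_equivP; rewrite -[x :: xs]/(map sgdec (v :: vs)) !size_map.
    split=> // i hi'; have hi2 : i < size (v :: vs) by rewrite /= hs.
    by rewrite (nth_map sgv0) ?size_map // (nth_map 0) //; apply: hlab.
  - apply/word_okP; split=> //; first by rewrite -[_ :: _]/(map vlab (x :: xs)) (map_comp (@lab c) fst); apply: labs.
      by case/sg_initP: hi => _ /andP[/eqP].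
    by rewrite last_map; case/andP: hl => /eqP.
  - by have := sg_initP hi => -[_ /andP[_]]; rewrite -/x -hr.
case=> l [ls [hw /word_okP[h1 h2 h3 h4] hacc]].
set xs := states (l :: ls); exists (map sgenc xs).
have sz : size xs = size w.
  have/word_equivP[<- _] := hw; by rewrite -[size xs](size_map vlab) states_lab.
split; first split=> //.
- by rewrite size_map.
- by apply/map_f; rewrite mem_filter mem_enum /sginit /vlab /= h2 hacc.
- rewrite /xs /= last_map map_f // mem_filter mem_enum andbT /sgfinal.
  rewrite last_map in h3.
  elim: ls l h3 {hw h1 h2 h4 hacc xs sz} => [|l' ls IH] l h3 /=.
    by rewrite [s_out _]h3 /=.
  exact: IH.
split=> i.
  rewrite size_map => hi; rewrite !(nth_map sgv0) //; last exact: ltnW.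
  have /(pathP sgv0)/(_ i hi) harc := path_states h4.
  apply/mapP; exists (nth sgv0 xs i, nth sgv0 xs i.+1) => //.
  by rewrite mem_filter mem_enum andbT; exact: harc.
move=> hi; have/word_equivP[s1 /(_ i hi)] := hw.
rewrite -states_lab -/xs (nth_map sgv0) ?sz // (nth_map sgv0) ?sz //.
by rewrite [sg_lab _ _]/= sgencK.
Qed.

End SliceGraph.

(** * Unit decomposition of an ordered digraph *)

Lemma filter_uniq_single (T : eqType) (a : pred T) s x : uniq s -> x \in s ->
  {in s, forall y, a y = (y == x)} -> filter a s = [:: x].
Proof.
move=> us xs h; rewrite -(filter_pred1_uniq us xs).
by apply: eq_in_filter => y /h ->.
Qed.

Lemma perm_flatten_filter (T U : eqType) (F : T -> U) (low_end : T -> nat) s k :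
  perm_eq (flatten [seq [seq F e | e <- s & low_end e == j] | j <- iota 0 k])
          [seq F e | e <- s & low_end e < k].
Proof.
elim: k => [|k IH].
  by rewrite /= (eq_filter (a2 := pred0)) ?filter_pred0.
rewrite -[k.+1]addn1 iotaD map_cat flatten_cat (perm_catr _ IH) /= cats0.
rewrite -map_cat; apply: perm_map; apply/permP => a.
rewrite count_cat !count_filter add0n -count_predUI.
rewrite [X in _ + X](eq_count (a2 := pred0)) ?count_pred0 ?addn0.
  by apply: eq_count => e /=; case: (a e) => //=; lia.
by move=> e /=; case: ltngtP; rewrite ?andbF.
Qed.

Section Decomp.
Variables (n c : nat) (es : seq (nat * nat)).
Hypothesis wfes : all (fun p => (p.1 < n) && (p.2 < n)) es.
Hypothesis noloop : all (fun p => p.1 != p.2) es.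
Hypothesis cuts : forall i, count (fun p => (p.1 < i) != (p.2 < i)) es <= c.

Let m := size es.
Let ed e := nth (0, 0) es e.
Definition low_end e := minn (ed e).1 (ed e).2.
Definition high_end e := maxn (ed e).1 (ed e).2.
(** The edges across the cut between the vertices below [i] and the others. [front_num] numbers them
    from 1, as the alphabet requires. *)
Definition crossing i := [seq e <- iota 0 m | low_end e < i <= high_end e].
Definition front_num i e := (index e (crossing i)).+1.
Definition strand_low i e : svtx := if low_end e < i then (0, front_num i e) else (1, 0).
Definition strand_high i e : svtx := if i < high_end e then (2, front_num i.+1 e) else (1, 0).
(** The piece of edge [e] seen in the slice of vertex [i]. Direction is recorded by the order of the
    ends, and the orientation value is constantly +1, which makes orientations match when gluing. *)
Definition strand i e : sedge :=
  if (ed e).1 < (ed e).2 then ((strand_low i e, strand_high i e), true)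
  else ((strand_high i e, strand_low i e), true).
Definition cut_slice i : slice := Slice 1 (iota 1 (size (crossing i)))
  (iota 1 (size (crossing i.+1))) [seq strand i e | e <- iota 0 m & low_end e <= i <= high_end e].

Lemma low_lt_high e : e < m -> low_end e < high_end e.
Proof.
by move=> he; have := allP noloop _ (mem_nth (0, 0) he); rewrite /low_end /high_end /ed /=; lia.
Qed.

Lemma high_end_lt e : e < m -> high_end e < n.
Proof.
by move=> he; have := allP wfes _ (mem_nth (0, 0) he); rewrite /high_end /ed /=; lia.
Qed.

Lemma mem_crossing i e : (e \in crossing i) = (e < m) && (low_end e < i <= high_end e).
Proof. by rewrite mem_filter mem_iota andbC. Qed.

Lemma crossing_uniq i : uniq (crossing i).
Proof. exact/filter_uniq/iota_uniq. Qed.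

Lemma size_crossing i : size (crossing i) <= c.
Proof.
apply: leq_trans (cuts i); rewrite size_filter -[X in _ <= count _ X](mkseq_nth (0, 0) es) count_map.
by apply: sub_count => e; rewrite /low_end /high_end /ed /=; lia.
Qed.

Lemma front_num_inj i e f : e \in crossing i -> (front_num i e == front_num i f) = (e == f).
Proof.
move=> he; apply/eqP/eqP => [[E]|->//].
have hf : f \in crossing i by rewrite -index_mem -E index_mem.
by rewrite -(nth_index 0 he) E nth_index.
Qed.

Lemma mem_front_num i e : e \in crossing i -> front_num i e \in iota 1 (size (crossing i)).
Proof. by rewrite mem_iota /= add1n ltnS index_mem. Qed.

Lemma front_numP i a : a \in iota 1 (size (crossing i)) -> exists2 e, e \in crossing i & a = front_num i e.
Proof.
rewrite mem_iota add1n ltnS => /andP[a0 ha]; have h : a.-1 < size (crossing i) by lia.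
exists (nth 0 (crossing i) a.-1); first exact: mem_nth.
by rewrite /front_num index_uniq ?crossing_uniq //; lia.
Qed.

Lemma strand_incident_in i a e : incident (0, a) (strand i e) = (low_end e < i) && (front_num i e == a).
Proof.
rewrite /incident /strand /strand_low /strand_high.
by case: ifP => _; case: ifP => _; case: ifP => _; rewrite /= !xpair_eqE /= ?orbF.
Qed.

Lemma strand_incident_out i a e :
  incident (2, a) (strand i e) = (i < high_end e) && (front_num i.+1 e == a).
Proof.
rewrite /incident /strand /strand_low /strand_high.
by case: ifP => _; case: ifP => _; case: ifP => _; rewrite /= !xpair_eqE /= ?orbF.
Qed.

Lemma cut_slice_edges_in i e : e \in crossing i ->
  [seq x <- s_edges (cut_slice i) | incident (0, front_num i e) x] = [:: strand i e].
Proof.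
move=> he; rewrite filter_map -filter_predI.
rewrite (@filter_uniq_single _ _ _ e) ?iota_uniq //.
  by move: he; rewrite mem_crossing mem_iota => /andP[].
move=> f; rewrite mem_iota add0n => /andP[_ hf] /=; rewrite strand_incident_in.
apply/andP/eqP => [[/andP[h1 /eqP h2] /andP[h3 h4]]|->].
  by apply/eqP; rewrite -(@front_num_inj i) ?h2 // mem_crossing hf h1.
by move: he; rewrite mem_crossing => /andP[_ /andP[h1 h2]]; rewrite h1 h2 eqxx ltnW.
Qed.

Lemma cut_slice_edges_out i e : e \in crossing i.+1 ->
  [seq x <- s_edges (cut_slice i) | incident (2, front_num i.+1 e) x] = [:: strand i e].
Proof.
move=> he; rewrite filter_map -filter_predI.
rewrite (@filter_uniq_single _ _ _ e) ?iota_uniq //.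
  by move: he; rewrite mem_crossing mem_iota => /andP[].
move=> f; rewrite mem_iota add0n => /andP[_ hf] /=; rewrite strand_incident_out.
apply/andP/eqP => [[/andP[h1 /eqP h2] /andP[h3 h4]]|->].
  by apply/eqP; rewrite -(@front_num_inj i.+1) ?h2 // mem_crossing hf ltnS h3.
by move: he; rewrite mem_crossing => /andP[_ /andP[h1 h2]]; rewrite h2 eqxx /=; lia.
Qed.

Lemma cut_slice_is_slice i : is_slice (cut_slice i).
Proof.
apply/and5P; split; try exact: iota_uniq.
- apply/allP => _ /mapP[e + ->]; rewrite mem_filter mem_iota add0n.
  case/andP=> /andP[h1 h2] /andP[_ he].
  have l : valid_sv (cut_slice i) (strand_low i e).
    by rewrite /strand_low; case: ifP => //= h; rewrite /valid_sv mem_front_num // mem_crossing he h.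
  have r : valid_sv (cut_slice i) (strand_high i e).
    rewrite /strand_high; case: ifP => //= h.
    by rewrite /valid_sv mem_front_num // mem_crossing he ltnS h1.
  have t1 : ((strand_low i e).1 == 2) = false by rewrite /strand_low; case: ifP.
  have t2 : ((strand_high i e).1 == 0) = false by rewrite /strand_high; case: ifP.
  by rewrite /strand; case: ifP => _ /=; rewrite l r t1 t2 ?andbF.
- by apply/allP => a /front_numP[e he ->]; rewrite -size_filter cut_slice_edges_in.
- by apply/allP => a /front_numP[e he ->]; rewrite -size_filter cut_slice_edges_out.
Qed.

Lemma cut_slice_alphabet i : in_alphabet c (cut_slice i).
Proof.
rewrite /in_alphabet /unit_slice cut_slice_is_slice /swidth /= !size_iota geq_max !size_crossing /=.
by rewrite all_cat; apply/andP; split; apply/allP => a; rewrite mem_iota;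
  have := size_crossing i; have := size_crossing i.+1; lia.
Qed.

Lemma cut_slice_gluable i : gluable (cut_slice i) (cut_slice i.+1).
Proof.
apply/andP; split; first exact: perm_refl.
apply/allP => a /front_numP[e he ->]; rewrite /edge_at cut_slice_edges_out // cut_slice_edges_in //=.
move: he; rewrite mem_crossing ltnS /strand => /andP[_ /andP[h1 h2]].
case: ifP => _ /=; rewrite /strand_low /strand_high; first by rewrite ltnS h1 h2 !eqxx.
by case: ifP; case: ifP.
Qed.

Definition decomp : seq slice := map cut_slice (iota 0 n).

Lemma decomp_vidx j : j <= n -> vidx decomp j 0 = j.
Proof.
move=> hj; rewrite /vidx /decomp -map_take take_iota (minn_idPl hj) addn0 -map_comp.
by rewrite sumnE big_map sum1_size size_iota.
Qed.

Lemma drop_decomp i : i < n -> drop i decomp = cut_slice i :: drop i.+1 decomp.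
Proof.
move=> hi'; have sz : i < size decomp by rewrite size_map size_iota.
by rewrite (drop_nth slice0 sz) (nth_map 0) ?size_iota // nth_iota.
Qed.

Lemma other_strand i e : low_end e < i -> other (strand i e) (0, front_num i e) = strand_high i e.
Proof.
move=> h; rewrite /other /strand /strand_low h; case: (_ < _); first by rewrite eqxx.
by rewrite /strand_high; case: (_ < _).
Qed.

(** The number of [e] may change from cut to cut, but a slice and its successor number their common
    cut alike, so the trace stays on [e] up to its higher end. *)
Lemma decomp_trace i e : e < m -> low_end e < i -> i <= high_end e ->
  trace (drop i decomp) (front_num i e) = Some (high_end e - i, 0).
Proof.
move=> he; have hn := high_end_lt he.
move Ek : (high_end e - i) => k; elim: k i Ek => [|k IH] i Ek h1 h2;
  (have hc : e \in crossing i by rewrite mem_crossing he h1); (have i_n : i < n by lia);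
  rewrite drop_decomp //= /edge_at cut_slice_edges_in //= other_strand // /strand_high.
  by have -> : (i < high_end e) = false by lia.
have -> : i < high_end e by lia.
by rewrite /= IH //; lia.
Qed.

Lemma decomp_gedge j e : e < m -> low_end e <= j <= high_end e ->
  gedge decomp j (strand j e) = if low_end e == j then [:: Some (ed e)] else [::].
Proof.
move=> he /andP[h1 h2]; have hn := high_end_lt he; have lh := low_lt_high he.
have [E|ne] := eqVneq (low_end e) j; last first.
  have hlt : low_end e < j by rewrite ltn_neqAle ne.
  by rewrite /gedge /strand /strand_low /strand_high hlt; case: (_ < _) => //=; case: (_ < _).
have hj : j < high_end e by rewrite -E.
have tr := @decomp_trace j.+1 e he; rewrite E ltnS leqnn in tr.
rewrite /gedge /strand /strand_low /strand_high E ltnn hj; move: tr; set r := drop _ _ => tr.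
have vj : vidx decomp j 0 = j by apply: decomp_vidx; lia.
have vh : vidx decomp (j.+1 + (high_end e - j.+1)) 0 = high_end e.
  by rewrite subnKC //; apply: decomp_vidx; lia.
case: (ltnP (ed e).1 (ed e).2) => lt; rewrite /= tr //= vj vh -E /low_end /high_end; congr [:: Some _];
  rewrite [RHS]surjective_pairing; congr (_, _); lia.
Qed.

Lemma decomp_glue_edges : glue_edges decomp =
  flatten [seq [seq Some (ed e) | e <- iota 0 m & low_end e == j] | j <- iota 0 n].
Proof.
rewrite /glue_edges size_map size_iota; congr flatten.
apply/eq_in_map => j; rewrite mem_iota add0n => /andP[_ hj].
rewrite (nth_map 0) ?size_iota // nth_iota // add0n /= -map_comp.
have -> : [seq e <- iota 0 m | low_end e == j] =
    [seq e <- [seq e <- iota 0 m | low_end e <= j <= high_end e] | low_end e == j].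
  rewrite -filter_predI; apply: eq_in_filter => e; rewrite mem_iota => /low_lt_high h /=.
  by case: eqP => // E /=; lia.
have : {in [seq e <- iota 0 m | low_end e <= j <= high_end e], forall e, e < m /\ low_end e <= j <= high_end e}.
  by move=> e; rewrite mem_filter mem_iota => /andP[h /andP[_]].
elim: [seq e <- iota 0 m | low_end e <= j <= high_end e] => //= e s IH hs.
have [h1 h2] := hs e (mem_head _ _); rewrite decomp_gedge // IH; last first.
  by move=> f hf; apply: hs; rewrite inE hf orbT.
by case: eqP.
Qed.

Lemma decomp_glue : perm_eq (de (glue decomp)) es.
Proof.
have -> : es = pmap id (map Some es) by elim: (es) => //= p s {1}->.
apply: perm_pmap; rewrite decomp_glue_edges (permPl (perm_flatten_filter _ _ _ _)).
have -> : [seq e <- iota 0 m | low_end e < n] = iota 0 m.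
  apply/all_filterP/allP => e; rewrite mem_iota => he.
  exact: ltn_trans (low_lt_high he) (high_end_lt he).
by rewrite -[X in perm_eq _ (map Some X)](mkseq_nth (0, 0)) -map_comp perm_refl.
Qed.

Lemma decomp_exists : exists w, [/\ word_ok w, all (in_alphabet c) w,
  dv (glue w) = n & perm_eq (de (glue w)) es].
Proof.
case En: n => [|n'].
  (* A word is nonempty, so the digraph without vertices is decomposed into a single empty slice. *)
  exists [:: slice0]; split=> //; case: es wfes => // p s /=.
  by rewrite En.
exists decomp; split.
- have Ed : decomp = cut_slice 0 :: map cut_slice (iota 1 n') by rewrite /decomp En.
  rewrite Ed; apply/word_okP; split.
  + by rewrite -Ed all_map; apply/allP => i _; apply: cut_slice_is_slice.
  + by rewrite /= /crossing (eq_filter (a2 := pred0)) ?filter_pred0.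
  + rewrite last_map; have -> : last 0 (iota 1 n') = n'.
      by case: (n') => // k; rewrite -[k.+1]addn1 iotaD last_cat /= add1n addn1.
    rewrite /= -En; suff -> : crossing n = [::] by [].
    rewrite /crossing -(filter_pred0 (iota 0 m)); apply: eq_in_filter => e.
    by rewrite mem_iota => /high_end_lt h /=; lia.
  + apply/(pathP slice0) => i; rewrite size_map size_iota => hi'.
    have sz : i.+1 < n by rewrite En.
    have -> : nth slice0 (map cut_slice (iota 1 n')) i = nth slice0 decomp i.+1 by rewrite Ed.
    rewrite -Ed !(nth_map 0) ?size_iota ?nth_iota //; try exact: ltnW.
    exact: cut_slice_gluable.
- by rewrite all_map; apply/allP => i _; apply: cut_slice_alphabet.
- rewrite -En -(decomp_vidx (leqnn n)) /vidx /= take_oversize ?addn0 //.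
  by rewrite size_map size_iota.
- exact: decomp_glue.
Qed.

End Decomp.

(** * The slice graph of a sentence *)

(** Consecutive vertices of a simple path differ. This gives every edge distinct lower and higher
    ends, and restricts the slices that occur to finitely many up to equivalence. *)
Lemma union_noloop H k : union_of_paths H k -> all (fun p => p.1 != p.2) (de H).
Proof.
move=> [ps [_ [/allP hp [_ he]]]]; apply/allP => _ /(nthP (0, 0))[e hm <-].
have [p /hp /dpathP[h1 h2 h3 h4 h5] /(nthP 0)[j hj <-]] := he e hm.
by rewrite -[nth _ (de H) _]/(dedge H _) h5 //= nth_uniq ?h2 // ?ltnS;
  [rewrite ltn_eqF | apply: ltnW].
Qed.

Lemma union_cut H k z i : dg_wf H -> union_of_paths H k ->
  ztopological H (iota 0 (dv H)) z ->
  count (fun p => (p.1 < i) != (p.2 < i)) (de H) <= k * z.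
Proof.
move=> wfH [ps [<- [/allP hp [_ he]]]] [_ hz].
(* Counting edge indices instead of pairs keeps parallel edges apart; each crossing index then
   appears in one of the [k] lists [cs p], of length at most [z]. *)
rewrite -[X in count _ X](mkseq_nth (0, 0)) count_map.
rewrite -size_filter.
pose cs (p : seq nat * seq nat) :=
  [seq e <- p.2 | crosses (iota 0 (dv H)) i (dedge H e)].
apply: (@leq_trans (size (flatten (map cs ps)))).
  apply: uniq_leq_size; first exact/filter_uniq/iota_uniq.
  move=> e; rewrite mem_filter mem_iota add0n => /andP[hc /= hm].
  have [p pp ep] := he e hm; apply/flattenP; exists (cs p); first exact: map_f.
  by rewrite mem_filter ep andbT crosses_iotaE.
elim: ps hp {he} => //= p ps IH hp; rewrite size_cat mulSn leq_add //.
  by rewrite size_filter; apply: hz; apply: hp; apply: mem_head.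
by apply: IH => q hq; apply: hp; rewrite inE hq orbT.
Qed.

Lemma glue_loopfree c w : all (in_alphabet c) w ->
  all (fun p => p.1 != p.2) (de (glue w)) -> all loopfree w.
Proof.
have -> : all (fun p => p.1 != p.2) (de (glue w)) =
    all (fun o : option (nat * nat) => if o is Some p then p.1 != p.2 else true)
      (glue_edges w).
  by rewrite /=; elim: (glue_edges w) => //= -[p|] s IHs; rewrite /= IHs.
elim: w => //= S r IH /andP[hS hr]; rewrite glue_edges_cons all_cat !all_map.
case/andP=> /allP hb hg; apply/andP; split; last first.
  by apply: IH => //; apply: sub_all hg => -[[x y]|] //=; rewrite eqn_add2l.
apply/allP => e he; apply/negP => /andP[/eqP t1 /eqP h1].
have := hb e; rewrite mem_filter he /born t1 h1 /= /bedge /vend t1 h1 /= => /(_ isT).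
have [] := slice_edge_valid (alphabet_slice hS) he; rewrite /valid_sv t1 h1.
have : s_nc S <= 1 by case/and3P: hS => /andP[].
(* With at most one center, an edge between centers has equal ends and would survive gluing as a
   loop. *)
move: (e.1.1.2) (e.1.2.2) (s_nc S) => x y n1 n2 hx hy; lia.
Qed.

Section Main.
Variables (phi : mso) (k z : nat).
Let c := k * z.

(** Variable 1 is the accumulator of [pcover]; evaluation in the empty environment starts it with
    nothing covered. *)
Lemma recog_target : recog c (fun w A B => wsat w A B phi /\
  pcover k (nverts w) (glue_edges w) (A 1) (B 1) /\
  ~ zigzag_bad z (nverts w) (glue_edges w)).
Proof.
exact: recog_and (recog_mso _ _)
  (recog_and (recog_pcover _ _) (recog_not (recog_zigzag_bad _ _))).
Qed.

Definition target_dfa : dfa := proj1_sig recog_target.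
Definition target_graph : slice_graph := dfa_graph c target_dfa.

Definition target (H : digraph) (om : seq nat) : Prop :=
  [/\ msat H phi, union_of_paths H k & ztopological H om z].

Hypothesis sphi : mso_sentence phi.

Lemma word_ok_slice w : word_ok w -> all is_slice w.
Proof. by case/and5P. Qed.

Lemma target_dfaP w : word_ok w -> all (in_alphabet c) w ->
  dacc (run target_dfa w (fun _ _ => false) (fun _ _ => false)) <->
  target (glue w) (iota 0 (dv (glue w))).
Proof.
move=> hw ha; have wfg := glue_wf (word_ok_slice hw).
have hn : all (fun o => o != None) (glue_edges w) by case/and5P: hw => _ _ _ _ /andP[].
have E := glue_edgesE hn.
have [_ ->] := proj2_sig recog_target; last by rewrite /good ha.
have h1 := wsat_sentence wfg E erefl sphi.
have h2 := pcover_union wfg k; have h3 := ztopological_iota wfg z; rewrite -E in h2 h3.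
by split=> [[/h1 ? [/h2 ? /h3 ?]]|[/h1 ? /h2 ? /h3 ?]].
Qed.

Lemma target_iso w H om : word_ok w -> dv (glue w) = dv H ->
  is_ordering (glue w) om -> perm_eq (map (relabel om) (de (glue w))) (de H) ->
  target (glue w) (iota 0 (dv (glue w))) <-> target H om.
Proof.
move=> hw hv ho hp; have wfg := glue_wf (word_ok_slice hw).
have [g [g' hi]] := perm_diso hv ho hp; have hi' := diso_sym wfg hi.
have hm := msat_iso wfg hi sphi; have ht := ztopological_iso z wfg ho hi.
by split=> -[/hm h1 h2 /ht h3]; split=> //;
  [apply: union_iso hi h2|apply: union_iso hi' h2].
Qed.

(** Equivalent words glue to isomorphic, not equal, digraphs, so invariance of the property lets
    acceptance of the label word speak about [w]. *)
Lemma target_word_equiv w w' : word_ok w -> word_equiv w w' ->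
  target (glue w) (iota 0 (dv (glue w))) <-> target (glue w') (iota 0 (dv (glue w'))).
Proof.
move=> hw h; have hs := word_ok_slice hw; have wfg := glue_wf hs.
have [g [g' hi]] := word_equiv_diso hs h; have hi' := diso_sym wfg hi.
have ho : is_ordering (glue w) (iota 0 (dv (glue w))) by apply: perm_refl.
have hm := msat_iso wfg hi sphi; have := ztopological_iso z wfg ho hi.
rewrite {2}(iso_dv hi) => ht.
by split=> -[/hm h1 h2 /ht h3]; split=> //;
  [apply: union_iso hi h2|apply: union_iso hi' h2].
Qed.

(** Encoding [w] by letters requires loop-free slices, which the target property supplies since a
    union of simple paths has no loops. *)
Lemma target_langP w : in_lang target_graph w <->
  [/\ word_ok w, all (in_alphabet c) w & target (glue w) (iota 0 (dv (glue w)))].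
Proof.
have labs ls : all (in_alphabet c) (map (@lab c) ls).
  by rewrite all_map; apply/allP => l _; apply: lab_alphabet.
rewrite in_lang_dfa; split.
  move=> [l [ls [h hw]]]; rewrite target_dfaP // (target_word_equiv hw h) => ht; split=> //.
    exact: word_equiv_word_ok h hw.
  exact: word_equiv_alphabet h (labs _).
case: w => [|S r] [hw ha ht] //; have lf : all loopfree (S :: r).
  by apply: (glue_loopfree ha); case: ht => _ /union_noloop.
have h : word_equiv (map (@lab c) (map (letter_of c) (S :: r))) (S :: r).
  elim: (S :: r) ha lf => //= T s IH /andP[hT hs] /andP[lT ls].
  by split; [apply: lab_letter_of | apply: IH].
have hw' := word_equiv_word_ok (word_equiv_sym h) hw.
exists (letter_of c S), (map (letter_of c) r); split=> //.
by rewrite target_dfaP ?(target_word_equiv hw' h) //; apply: labs.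
Qed.

Lemma target_LG H : dg_wf H -> in_LG target_graph H <->
  zigzag_le H z /\ msat H phi /\ union_of_paths H k.
Proof.
move=> wfH; split.
  move=> [w [/target_langP[_ _ ht] [hw [hv [om [ho hp]]]]]].
  have [h1 h2 h3] := (target_iso hw hv ho hp).1 ht.
  by split; [exists om | split].
move=> [[om hz] [hs hu]]; have [ho _] := hz.
have hoP := perm_iota_cancel ho.
(* [G] is [H] renumbered so that [om] becomes the natural order, the case treated by the
   decomposition into cut slices. *)
pose G := Digraph (dv H) [seq (index p.1 om, index p.2 om) | p <- de H].
have wfG : dg_wf G.
  rewrite /dg_wf all_map; apply: sub_all wfH => p /= /andP[h1 h2].
  by have [_ -> _ _] := hoP _ h1; have [_ -> _ _] := hoP _ h2.
have E : map (relabel om) (de G) = de H.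
  rewrite -map_comp -[RHS]map_id; apply/eq_in_map => p /(allP wfH)/andP[h1 h2] /=.
  have [_ _ _ e1] := hoP _ h1; have [_ _ _ e2] := hoP _ h2.
  by rewrite /relabel /= e1 e2 -surjective_pairing.
have hpG : perm_eq (map (relabel om) (de G)) (de H) by rewrite E.
have [g [g' hi]] := perm_diso (erefl : dv G = dv H) ho hpG.
have uG := union_iso (diso_sym wfG hi) hu.
have zG := (ztopological_iso z wfG ho hi).2 hz.
have [w [hw ha hv hp]] :=
  decomp_exists wfG (union_noloop uG) (fun i => union_cut i wfG uG zG).
have how : is_ordering (glue w) om by rewrite /is_ordering hv.
have hpw : perm_eq (map (relabel om) (de (glue w))) (de H).
  by rewrite -E; apply: perm_map.
exists w; split.
  by apply/target_langP; split=> //; apply: (target_iso (H := H) hw hv how hpw).2.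
by split=> //; split=> //; exists om.
Qed.

Lemma target_saturated : dilated_saturated z c target_graph.
Proof.
split=> [w /target_langP[_ _ []] //|H wfH hL om hz w [hw ha hv hp]].
apply/target_langP; split=> //.
have ho : is_ordering (glue w) om by rewrite /is_ordering hv; case: hz.
apply: (target_iso hw hv ho hp).2.
(* Membership of [H] yields the two properties that do not mention an ordering; the zig-zag bound
   for [om] is the hypothesis of saturation. *)
by have /(target_LG wfH)[_ [h1 h2]] := hL.
Qed.

End Main.

Theorem theorem7 :
  { F : mso -> nat -> nat -> slice_graph |
    forall (phi : mso) (k z : nat), mso_sentence phi ->
      sg_wf (k * z) (F phi k z) /\
      dilated_saturated z (k * z) (F phi k z) /\
      (forall H : digraph, dg_wf H ->
         (in_LG (F phi k z) H <->
          zigzag_le H z /\ msat H phi /\ union_of_paths H k)) }.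
Proof.
exists target_graph => phi k z sphi; split; first exact: dfa_graph_wf.
split; first exact: target_saturated.
by move=> H; apply: target_LG.
Qed.
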